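(* Let $\Phi(x)=\mathbb{E}_{\xi\sim\mathcal P}[\phi(x,\xi)]$ be $L$-smooth, and assume $\max_{x\in\mathcal X,\ \xi\in\mathrm{supp}(\mathcal P)}\|\mathrm{grad}\,\phi(x,\xi)\|\le C$ for some constant $C\ge 0$. Then the algorithm SRFW (see context), run with $\eta_k=1/\sqrt K$ and $b_k=K$ for a suitable number $K=K(\epsilon)$ of iterations, obtains an $\epsilon$-accurate solution, i.e. $\mathbb E[\mathcal G(\hat x)]\le\epsilon$, with SFO complexity $O\left(\frac1{\epsilon^4}\right)$ and RLO complexity $O\left(\frac1{\epsilon^2}\right)$ (as $\epsilon\to0$, implied constants depending only on the problem data and $x_0$).
   Context: Setting: $\mathcal M$ is a Riemannian manifold with inner products $\langle\cdot,\cdot\rangle_x$ and norms $\|\cdot\|_x$ on tangent spaces $T_x\mathcal M$ and geodesic distance $d$. For $x,y\in\mathcal M$, $\mathrm{Exp}_x^{-1}(y)\in T_x\mathcal M$ is the inverse exponential map; it is assumed to be well defined for all points considered, with $\|\mathrm{Exp}_x^{-1}(y)\|_x=d(x,y)$, and ''the geodesic $\gamma:[0,1]\to\mathcal M$ with $\gamma(0)=x$, $\gamma(1)=y$'' is $\gamma(t)=\mathrm{Exp}_x(t\,\mathrm{Exp}_x^{-1}(y))$. $\Gamma_x^y:T_x\mathcal M\to T_y\mathcal M$ is parallel transport along this geodesic. $\mathcal X\subset\mathcal M$ is compact and geodesically convex (the geodesic between two points of $\mathcal X$ stays in $\mathcal X$). $\mathrm{grad}$ is the Riemannian gradient (in the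 first argument for $\phi(\cdot,\xi)$). A differentiable $f:\mathcal M\to\mathbb R$ is $L$-smooth if $\|\mathrm{grad}\,f(y)-\Gamma_x^y\,\mathrm{grad}\,f(x)\|\le L\,d(x,y)$ for all $x,y\in\mathcal M$. Stochastic gradients are unbiased: $\mathbb E_{\xi\sim\mathcal P}[\mathrm{grad}\,\phi(x,\xi)]=\mathrm{grad}\,\Phi(x)$. No convexity of $\Phi$ is assumed. Frank-Wolfe gap: $\mathcal G(x)=\max_{y\in\mathcal X}\langle\mathrm{Exp}_x^{-1}(y),-\mathrm{grad}\,\Phi(x)\rangle_x$. Algorithm SRFW: given $x_0\in\mathcal X$, a number of iterations $K$, minibatch sizes $b_k$ and step sizes $\eta_k$, for $k=0,\dots,K-1$: draw $\xi_1,\dots,\xi_{b_k}$ i.i.d. from $\mathcal P$ (fresh, independent of the past); let $$y_k\in\operatorname{argmin}_{y\in\mathcal X}\Big\langle \tfrac{1}{b_k}\sum_{i=1}^{b_k}\mathrm{grad}\,\phi(x_k,\xi_i),\ \mathrm{Exp}_{x_k}^{-1}(y)\Big\rangle_{x_k};$$ set $x_{k+1}=\gamma(\eta_k)$, where $\gamma$ is the geodesic with $\gamma(0)=x_k$, $\gamma(1)=y_k$. The output $\hat x$ is chosen uniformly at random from $\{x_0,\dots,x_{K-1}\}$. Complexities: the SFO (stochastic first-order oracle), on input $x$, returns $(\phi(x,\xi'),\mathrm{grad}\,\phi(x,\xi'))$ for a sample $\xi'$ drawn i.i.d. from $\mathcal P$; the RLO (Riemannian linear optimization oracle), on input $x\in\mathcal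 X$ and $g\in T_x\mathcal M$, returns an element of $\operatorname{argmin}_{z\in\mathcal X}\langle g,\mathrm{Exp}_x^{-1}(z)\rangle$. SFO (RLO) complexity is the number of SFO (RLO) calls made by the algorithm: iteration $k$ uses $b_k$ SFO calls and one RLO call. *)

(* Defs.v *)
From HB Require Import structures.
From mathcomp Require Import all_boot all_order all_algebra.
From mathcomp Require Import all_classical all_reals all_analysis.

Set Implicit Arguments.
Unset Strict Implicit.
Unset Printing Implicit Defensive.

Import Order.TTheory GRing.Theory Num.Theory.
Import numFieldNormedType.Exports.

Local Open Scope classical_set_scope.
Local Open Scope ring_scope.

(* Smooth and Riemannian manifolds are defined by atlases and Gram matrices;
   velocity, length, distance, Levi-Civita derivative, parallel transport,
   geodesics, exponential map and gradient by their usual local expressions. *)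

Fixpoint class_C (R : realType) (V W : normedModType R) (k : nat) (U : set V)
    (f : V -> W) : Prop :=
  if k is k'.+1 then
    (forall u, U u -> differentiable f u) /\
    (forall v, class_C k' U (fun u => 'D_v f u))
  else forall u, U u -> {for u, continuous f}.

Definition smooth_on (R : realType) (V W : normedModType R) (U : set V)
    (f : V -> W) : Prop := forall k, class_C k U f.

(* The atlas is indexed by the points of M: [chart p] is a chosen chart around
   p, with domain [dom p].  Any smooth atlas yields one of this form with the
   same smooth structure. *)
Record manifold (R : realType) (n : nat) (M : ptopologicalType) := Manifold {
  chart : M -> M -> 'rV[R]_n ;
  chart_inv : M -> 'rV[R]_n -> M ;
  dom : M -> set M ;
  manifold_hausdorff : hausdorff_space M ;
  manifold_countable : @second_countable M ;
  dom_open : forall p, open (dom p) ;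
  dom_center : forall p, dom p p ;
  cod_open : forall p, open (chart p @` dom p) ;
  chartK : forall p x, dom p x -> chart_inv p (chart p x) = x ;
  chart_continuous : forall p x, dom p x -> {for x, continuous (chart p)} ;
  chart_inv_continuous : forall p x, dom p x ->
    {for chart p x, continuous (chart_inv p)} ;
  transition_smooth : forall p q,
    smooth_on (chart p @` (dom p `&` dom q)) (chart q \o chart_inv p)
}.

Section tangent.
Context {R : realType} {n : nat} {M : ptopologicalType}.

(* A tangent vector at x is represented by its coordinates in the chart
   [chart x], so that T_x M is 'rV[R]_n for every x.  [tcoord A p q x] turns
   the coordinates in [chart p] of a tangent vector at x into its coordinates
   in [chart q]. *)
Definition tcoord (A : manifold R n M) (p q x : M) (v : 'rV[R]_n) : 'rV[R]_n :=
  'd (chart A q \o chart_inv A p) (chart A p x) v.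

Definition mdifferentiable (A : manifold R n M) (f : M -> R) (x : M) : Prop :=
  differentiable (f \o chart_inv A x) (chart A x x).

End tangent.

(* [gram p u] is the matrix (g_ij) of the metric in the chart [chart p], at the
   point with coordinates u. *)
Record riemannian (R : realType) (n : nat) (M : ptopologicalType) :=
  Riemannian {
  atlas :> manifold R n M ;
  gram : M -> 'rV[R]_n -> 'M[R]_n ;
  gram_smooth : forall p, smooth_on (chart atlas p @` dom atlas p) (gram p) ;
  gram_sym : forall p x, dom atlas p x ->
    (gram p (chart atlas p x))^T = gram p (chart atlas p x) ;
  gram_posdef : forall p x (v : 'rV[R]_n), dom atlas p x -> v != 0 ->
    0 < (v *m gram p (chart atlas p x) *m v^T) 0 0 ;
  gram_compat : forall p q x (u v : 'rV[R]_n),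
    dom atlas p x -> dom atlas q x ->
    tcoord atlas p q x u *m gram q (chart atlas q x) *m
      (tcoord atlas p q x v)^T =
    u *m gram p (chart atlas p x) *m v^T
}.

Section geometry.
Context {R : realType} {n : nat} {M : ptopologicalType}.
Variable g : riemannian R n M.
Implicit Types (x y p : M) (u v : 'rV[R]_n) (c : R -> M).

Definition inner x u v : R := (u *m gram g x (chart g x x) *m v^T) 0 0.

Definition tnorm x v : R := Num.sqrt (inner x v v).

(* (grad f)^i = sum_j g^{ij} d_j f *)
Definition grad (f : M -> R) x : 'rV[R]_n :=
  (\row_j 'D_(delta_mx 0 j) (f \o chart_inv g x) (chart g x x)) *m
  invmx (gram g x (chart g x x)).

(* Curves on [0, 1] are total functions on R, of which only the values on a
   neighbourhood of [0, 1] matter. *)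
Definition near01 (Q : R -> Prop) : Prop :=
  exists2 e : R, 0 < e & forall t, - e < t < 1 + e -> Q t.

Definition velocity c (t : R) : 'rV[R]_n := derive1 (chart g (c t) \o c) t.

Definition C1_at c (t : R) : Prop :=
  {for t, continuous c} /\
  forall p, dom g p (c t) ->
    derivable (chart g p \o c) t 1 /\
    {for t, continuous (derive1 (chart g p \o c))}.

Definition curve_length c : R :=
  \int[lebesgue_measure]_(t in `[0, 1]) tnorm (c t) (velocity c t).

(* [path_length x y l]: some piecewise C^1 curve from x to y has length l. *)
Inductive path_length : M -> M -> R -> Prop :=
| path_nil x : path_length x x 0
| path_cons c y l : near01 (C1_at c) -> path_length (c 1) y l ->
    path_length (c 0) y (curve_length c + l).

Definition dist x y : R := inf [set l | path_length x y l].

(* Gamma^k_ij in the chart [chart p], at the point x *)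
Definition christoffel p x (k i j : 'I_n) : R :=
  let D l (a b : 'I_n) :=
    'D_(delta_mx 0 l) (fun z => gram g p z a b) (chart g p x) in
  2^-1 * \sum_l invmx (gram g p (chart g p x)) k l *
    (D i j l + D j i l - D l i j).

(* A vector field along c assigns to t the coordinates of a tangent vector at
   c t in [chart (c t)]. *)
Definition field_in p c (V : R -> 'rV[R]_n) (t : R) : 'rV[R]_n :=
  tcoord g (c t) p (c t) (V t).

(* Coordinates in [chart p] of the Levi-Civita derivative of V along c. *)
Definition covariant_derivative p c (V : R -> 'rV[R]_n) (t : R) : 'rV[R]_n :=
  derive1 (field_in p c V) t +
  \row_k \sum_i \sum_j christoffel p (c t) k i j *
    derive1 (chart g p \o c) t 0 i * field_in p c V t 0 j.

Definition parallel_at c (V : R -> 'rV[R]_n) (t : R) : Prop :=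
  forall p, dom g p (c t) ->
    derivable (field_in p c V) t 1 /\ covariant_derivative p c V t = 0.

Definition geodesic c : Prop :=
  near01 (C1_at c) /\ near01 (parallel_at c (velocity c)).

(* Exp_x v is defined and equal to y *)
Definition is_exp x v y : Prop :=
  exists c, [/\ geodesic c, c 0 = x, velocity c 0 = v & c 1 = y].

(* [Log x y] is Exp_x^{-1}(y).  The inverse is the one of norm [dist x y], and
   it is only required to be unique among the preimages of that norm. *)
Definition inverse_exp (Log : M -> M -> 'rV[R]_n) : Prop :=
  forall x y, [/\ is_exp x (Log x y) y, tnorm x (Log x y) = dist x y &
    forall v, is_exp x v y -> tnorm x v = dist x y -> v = Log x y].

Section with_inverse_exp.
Variable Log : M -> M -> 'rV[R]_n.

(* t |-> Exp_x (t Log x y) *)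
Definition geodesic_between x y c : Prop :=
  [/\ geodesic c, c 0 = x, velocity c 0 = Log x y & c 1 = y].

Definition parallel_transport (Gamma : M -> M -> 'rV[R]_n -> 'rV[R]_n) : Prop :=
  forall x y c, geodesic_between x y c -> forall v,
    exists V, [/\ near01 (parallel_at c V), V 0 = v & V 1 = Gamma x y v].

Definition geodesically_convex (X : set M) : Prop :=
  forall x y c, X x -> X y -> geodesic_between x y c ->
    forall t, 0 <= t <= 1 -> X (c t).

Definition L_smooth (Gamma : M -> M -> 'rV[R]_n -> 'rV[R]_n) (L : R)
    (f : M -> R) : Prop :=
  (forall x, mdifferentiable g f x) /\
  (forall x y, tnorm y (grad f y - Gamma x y (grad f x)) <= L * dist x y).

(* For x in a compact geodesically convex X the supremum is attained, and is
   thus the maximum over X. *)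
Definition FW_gap (X : set M) (f : M -> R) x : R :=
  sup [set inner x (Log x y) (- grad f x) | y in X].

End with_inverse_exp.
End geometry.

(* M with its Borel sigma-algebra *)
Definition borel (M : ptopologicalType) := g_sigma_algebraType (@open M).

Section stochastic.
Context {R : realType} {n : nat} {M : ptopologicalType}.
Variables (g : riemannian R n M) (Log : M -> M -> 'rV[R]_n) (X : set M).
Context {dX : measure_display} {Xi : measurableType dX}.
Variables (P : probability Xi R) (phi : M -> Xi -> R).

Definition objective (x : M) : R := fine ('E_P[phi x])%E.

Definition unbiased : Prop :=
  forall x (j : 'I_n),
    let G xi : R := grad g (phi^~ xi) x 0 j in
    P.-integrable setT (EFin \o G) /\
    ('E_P[G] = (grad g objective x 0 j)%R%:E)%E.

Variables (x0 : M) (K : nat) (b : nat -> nat) (eta : nat -> R).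
Context {d : measure_display} {Omega : measurableType d}.
Variables (mu : probability Omega R) (xi : nat -> nat -> Omega -> Xi).
Variables (x y : nat -> Omega -> M) (kappa : Omega -> nat).

Definition minibatch_grad (k : nat) (w : Omega) : 'rV[R]_n :=
  (b k)%:R^-1 *: \sum_(i < b k) grad g (phi^~ (xi k i w)) (x k w).

(* Generators of the sigma-algebra of the past at the beginning of iteration k:
   the iterates up to x_k, and the oracle answers and samples of the earlier
   iterations. *)
Definition past (k : nat) : set (set Omega) :=
  [set A | exists j (B : set (borel M)),
     [/\ (j <= k)%N, measurable B & A = x j @^-1` B]] `|`
  [set A | exists j (B : set (borel M)),
     [/\ (j < k)%N, measurable B & A = y j @^-1` B]] `|`
  [set A | exists j i (B : set Xi),
     [/\ (j < k)%N, (i < b j)%N, measurable B & A = xi j i @^-1` B]].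

(* A run of SRFW on the probability space (Omega, mu).  [xi k i] is the i-th
   sample (from 0) of iteration k, and the output is x_kappa.  The product rule
   [run_fresh] says that the samples of iteration k are i.i.d. of law P and
   jointly independent of the past; [run_output] says that kappa is uniform on
   {0, ..., K-1} and independent of the whole run. *)
Record srfw_run : Prop := SrfwRun {
  run_x_measurable : forall k, (k <= K)%N ->
    measurable_fun setT (x k : Omega -> borel M) ;
  run_y_measurable : forall k, (k < K)%N ->
    measurable_fun setT (y k : Omega -> borel M) ;
  run_xi_measurable : forall k i, (k < K)%N -> (i < b k)%N ->
    measurable_fun setT (xi k i) ;
  run_fresh : forall k, (k < K)%N ->
    forall (A : set Omega) (B : nat -> set Xi),
      <<s past k >> A -> (forall i, measurable (B i)) ->
      (mu (A `&` \bigcap_(i in `I_(b k)) (xi k i @^-1` B i)) =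
       mu A * \prod_(i < b k) P (B i))%E ;
  run_init : forall w, x 0%N w = x0 ;
  run_oracle : forall k w, (k < K)%N -> X (y k w) /\
    forall z, X z ->
      inner g (x k w) (minibatch_grad k w) (Log (x k w) (y k w)) <=
      inner g (x k w) (minibatch_grad k w) (Log (x k w) z) ;
  run_step : forall k w, (k < K)%N -> exists c,
    geodesic_between g Log (x k w) (y k w) c /\ x k.+1 w = c (eta k) ;
  run_kappa_lt : forall w, (kappa w < K)%N ;
  run_kappa_measurable : measurable_fun setT kappa ;
  run_output : forall k (A : set Omega), (k < K)%N -> <<s past K >> A ->
    (mu (A `&` kappa @^-1` [set k]) = mu A * (K%:R^-1)%:E)%E
}.

Definition output (w : Omega) : M := x (kappa w) w.

End stochastic.

(* Iteration k makes b_k calls to the SFO and one call to the RLO. *)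
Definition sfo_complexity (K : nat) (b : nat -> nat) : nat :=
  (\sum_(k < K) b k)%N.

Definition rlo_complexity (K : nat) : nat := (\sum_(k < K) 1)%N.

(* Main.v *)
Require Import Defs.
From HB Require Import structures.
From mathcomp Require Import all_boot all_order all_algebra.
From mathcomp Require Import all_classical all_reals all_analysis.
From mathcomp Require Import measurable_realfun ring lra.

(** The proof is the Frank-Wolfe argument for smooth non-convex objectives, made
    quantitative in the noise of the minibatches.

    Geometry. Parallel fields have constant inner products
    ([inner_parallel_cst]), because the Christoffel symbols cancel the derivative
    of the metric. Hence geodesics have constant speed, initial segments of
    minimizing geodesics are minimizing ([dist_segment]), and the uniqueness in
    the inverse exponential map gives Log x (c t) = t Log x y along the geodesic
    c from x to y. L-smoothness therefore applies along c itself and gives the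
    descent lemma ([smooth_descent])
      f (c eta) <= f x + eta <grad f x, Log x y> + eta ^ 2 |L| D ^ 2.
    A finite diameter D of X exists because nearby points are joined by short
    segments in charts ([compact_bounded_dist]).

    One iteration. Let s = sqrt K, so that the step is 1 / s. Since y_k minimizes
    the linear form of the minibatch gradient v_k over X, the descent lemma
    bounds the gap at x_k ([gap_step]) by
      s (Phi x_k - Phi x_(k+1)) + D (s |v_k - grad Phi x_k| ^ 2 + 1 / s)
        + |L| D ^ 2 / s.

    Expectation. The squared error of the minibatch is K ^ -2 times the sum over
    i, j of the inner products of the noises of samples i and j. Fresh samples
    are independent of the past and of each other, so the terms with i <> j have
    mean 0 ([integral_noise_product], [fresh_sample_indep]) and the K others are
    at most 4 C ^ 2: the mean squared error is at most 4 C ^ 2 / K, and s times it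
    is O (1 / s). Summing over k telescopes the differences of Phi, and averaging
    over the independent uniform index kappa bounds the expected gap of the
    output by B / sqrt K with B depending only on the data
    ([srfw_expected_gap]). Then K of order (B / eps) ^ 2 suffices; it costs K
    linear oracle calls and K ^ 2 samples.

    Two points of measurability need care. The gap need not be measurable, and
    its expectation is a lower integral; it is non-negative, so a measurable
    pointwise upper bound suffices ([ge0_le_integral_nonmeasurable]). Gradients
    are coordinate vectors in charts chosen arbitrarily at each point, so that
    only their inner products are measurable functions of the point
    ([measurable_inner_grad]); this is why the squared norm, and not the error
    vector, enters the estimates. *)

Set Implicit Arguments.
Unset Strict Implicit.
Unset Printing Implicit Defensive.

Import Order.TTheory GRing.Theory Num.Theory.
Import numFieldNormedType.Exports.

Local Open Scope classical_set_scope.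
Local Open Scope ring_scope.

(** * Calculus along curves and in charts *)

Section calculus.
Context {R : realType}.

Lemma derivable_compose (V W : normedModType R) (f : R -> V) (h : V -> W) t :
  derivable f t 1 -> differentiable h (f t) -> derivable (h \o f) t 1.
Proof.
move=> /derivable1_diffP df dh; apply/derivable1_diffP.
exact: differentiable_comp.
Qed.

Lemma derive1_compose (V W : normedModType R) (f : R -> V) (h : V -> W) t :
  derivable f t 1 -> differentiable h (f t) ->
  derive1 (h \o f) t = 'd h (f t) (derive1 f t).
Proof.
move=> /derivable1_diffP df dh.
rewrite derive1E'; last exact: differentiable_comp.
by rewrite diff_comp//= [in RHS]derive1E'.
Qed.

Lemma derive_compose (U V W : normedModType R) (f : U -> V) (h : V -> W) x v :
  differentiable f x -> differentiable h (f x) ->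
  'D_v (h \o f) x = 'd h (f x) ('d f x v).
Proof.
move=> df dh; rewrite deriveE; last exact: differentiable_comp.
by rewrite diff_comp.
Qed.

Lemma near_eq_derive1 (V : normedModType R) (f h : R -> V) t :
  {near t, f =1 h} -> derive1 f t = derive1 h t.
Proof. by move=> fh; rewrite !derive1E; exact: near_eq_derive. Qed.

Lemma derive1_entry m k (f : R -> 'M[R]_(m, k)) t i j :
  derivable f t 1 -> is_derive t 1 (fun s => f s i j) (derive1 f t i j).
Proof.
move=> df; rewrite derive1E derive_mx// mxE.
by apply/derivableP; move/derivable_mxP : df.
Qed.

Lemma is_derive_bigsum (V : normedModType R) m (f : 'I_m -> V -> R) (df : 'I_m -> R)
    (t v : V) :
  (forall i, is_derive t v (f i) (df i)) ->
  is_derive t v (fun s => \sum_i f i s) (\sum_i df i).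
Proof.
move=> H; have := @is_derive_sum R V R m f t v df H.
congr (is_derive _ _ _ _); apply/funext => s; by rewrite fct_sumE.
Qed.

End calculus.

Lemma mulmx_form (R : comPzRingType) m (u v : 'rV[R]_m) (G : 'M[R]_m) :
  (u *m G *m v^T) 0 0 = \sum_i \sum_j u 0 i * G i j * v 0 j.
Proof.
rewrite mxE exchange_big/=; apply: eq_bigr => j _.
by rewrite !mxE mulr_suml; apply: eq_bigr.
Qed.

Section charts.
Context {R : realType} {n : nat} {M : ptopologicalType}.
Variable g : riemannian R n M.
Implicit Types (x y p q : M) (c : R -> M).

Lemma chart_in_cod p x : dom g p x -> (chart g p @` dom g p) (chart g p x).
Proof. by move=> px; exists x. Qed.

Lemma nbhs_dom p x : dom g p x -> nbhs x (dom g p).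
Proof. by move=> px; apply: open_nbhs_nbhs; split => //; exact: dom_open. Qed.

Lemma nbhs_cod p x : dom g p x -> nbhs (chart g p x) (chart g p @` dom g p).
Proof.
move=> px; apply: open_nbhs_nbhs; split; first exact: cod_open.
exact: chart_in_cod.
Qed.

Lemma near_dom c p t : {for t, continuous c} -> dom g p (c t) ->
  \forall s \near t, dom g p (c s).
Proof. by move=> cc pc; apply: cc; exact: nbhs_dom. Qed.

Lemma transition_differentiable p q x : dom g p x -> dom g q x ->
  differentiable (chart g q \o chart_inv g p) (chart g p x).
Proof.
move=> px qx; have [+ _] := @transition_smooth _ _ _ g p q 1%N.
by apply; exists x.
Qed.

Lemma gram_differentiable p x : dom g p x ->
  differentiable (gram g p) (chart g p x).
Proof. by move=> px; have [+ _] := @gram_smooth _ _ _ g p 1%N; apply; exists x. Qed.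

(** The two transition maps are inverse to each other near the point, so their
    differentials are inverse by the chain rule. *)
Lemma tcoordK p q x v : dom g p x -> dom g q x ->
  tcoord g q p x (tcoord g p q x v) = v.
Proof.
move=> px qx; rewrite /tcoord.
have dpq := transition_differentiable px qx.
have dqp := transition_differentiable qx px.
have e : (chart g q \o chart_inv g p) (chart g p x) = chart g q x by rewrite /= chartK.
rewrite -e in dqp *.
transitivity ('D_v ((chart g p \o chart_inv g q) \o (chart g q \o chart_inv g p))
             (chart g p x)).
  exact: esym (derive_compose v dpq dqp).
rewrite -[RHS](derive_id (chart g p x)); apply: near_eq_derive.
have : \forall u \near chart g p x,
    (chart g p @` (dom g p `&` dom g q)) u.
  have : \forall u \near chart g p x, dom g q (chart_inv g p u).
    apply: chart_inv_continuous => //; rewrite chartK//; exact: nbhs_dom.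
  move=> H; have := nbhs_cod px; move=> H'; near=> u.
  have [z pz zu] : (chart g p @` dom g p) u by near: u.
  have : dom g q (chart_inv g p u) by near: u.
  by rewrite -zu chartK// => qz; exists z.
move=> H; near=> u; have [z [pz qz] <-] : (chart g p @` (dom g p `&` dom g q)) u by near: u.
by rewrite /= !chartK.
Unshelve. all: by end_near. Qed.

(** The inner product at x is defined in the chart centred at x. Along a curve
    that chart moves, so derivatives are taken in the fixed chart p, where the
    coordinate expression of the inner product is smooth in the point. *)
Lemma inner_in_chart p x u v : dom g p x ->
  inner g x u v = \sum_i \sum_j tcoord g x p x u 0 i * gram g p (chart g p x) i j *
                    tcoord g x p x v 0 j.
Proof.
move=> px; rewrite /inner -(@gram_compat _ _ _ g x p)//; last exact: dom_center.
exact: mulmx_form.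
Qed.

(** A positive definite matrix has no kernel. *)
Lemma gram_unit p x : dom g p x -> gram g p (chart g p x) \in unitmx.
Proof.
move=> px; rewrite -row_free_unit; apply/row_freeP; apply/row_freeP.
rewrite -kermx_eq0; apply/rowV0P => v /sub_kermxP vG.
apply/eqP/negPn/negP => v0.
by have := gram_posdef px v0; rewrite vG mul0mx mxE ltxx.
Qed.

End charts.

(** * Parallel fields have constant inner products *)

Section parallel.
Context {R : realType} {n : nat} {M : ptopologicalType}.
Variable g : riemannian R n M.
Implicit Types (x y p q : M) (c : R -> M).

Definition dgram p x (l a b : 'I_n) : R :=
  'D_(delta_mx 0 l) (fun z => gram g p z a b) (chart g p x).

Lemma gram_symE p x i j : dom g p x ->
  gram g p (chart g p x) i j = gram g p (chart g p x) j i.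
Proof. by move=> px; rewrite -[in LHS](gram_sym px) mxE. Qed.

(** The Gram matrix is symmetric on the whole open chart domain, and only
    because of that its derivatives are. *)
Lemma dgram_sym p x l a b : dom g p x -> dgram p x l a b = dgram p x l b a.
Proof.
move=> px; apply: near_eq_derive; near=> u.
have [z pz <-] : (chart g p @` dom g p) u by near: u; exact: nbhs_cod.
exact: gram_symE.
Unshelve. all: by end_near. Qed.

(** Lowering the upper index cancels the inverse Gram matrix and leaves the
    Christoffel symbols of the first kind. *)
Lemma christoffel_first_kind p x i j m : dom g p x ->
  \sum_k christoffel g p x k i j * gram g p (chart g p x) k m =
  2^-1 * (dgram p x i j m + dgram p x j i m - dgram p x m i j).
Proof.
move=> px; rewrite /christoffel -/(dgram _ _ _ _ _).
under eq_bigr => k _ do rewrite -mulrA mulr_suml.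
rewrite -mulr_sumr exchange_big/=; congr (_ * _).
transitivity (\sum_l (dgram p x i j l + dgram p x j i l - dgram p x l i j) *
   (l == m)%:R).
  apply: eq_bigr => l _.
  transitivity ((dgram p x i j l + dgram p x j i l - dgram p x l i j) *
     \sum_k gram g p (chart g p x) m k * invmx (gram g p (chart g p x)) k l).
    rewrite mulr_sumr; apply: eq_bigr => k _.
    by rewrite (gram_symE k m px) /dgram; ring.
  congr (_ * _).
  have := mulmxV (gram_unit px) => /matrixP/(_ m l); rewrite !mxE => ->.
  by rewrite eq_sym.
by rewrite (bigD1 m)//= eqxx mulr1 big1 ?addr0// => l /negPf ->; rewrite mulr0.
Qed.

Lemma is_derive_gram_along c p t i j :
  dom g p (c t) -> derivable (chart g p \o c) t 1 ->
  is_derive t 1 (fun s => gram g p (chart g p (c s)) i j)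
    (\sum_l derive1 (chart g p \o c) t 0 l * dgram p (c t) l i j).
Proof.
move=> pc dc.
have dG : differentiable (fun z => gram g p z i j) (chart g p (c t)).
  have := differentiable_comp (gram_differentiable pc)
    (differentiable_coord (gram g p (chart g p (c t))) i j).
  by [].
have -> : \sum_l derive1 (chart g p \o c) t 0 l * dgram p (c t) l i j =
    derive1 ((fun z => gram g p z i j) \o (chart g p \o c)) t.
  rewrite derive1_compose// {2}[derive1 (chart g p \o c) t]row_sum_delta linear_sum.
  by apply: eq_bigr => l _; rewrite linearZ/= /dgram deriveE.
rewrite derive1E; apply: derivableP; exact: (derivable_compose dc dG).
Qed.

(** Metric compatibility of the Levi-Civita connection. With xd the velocity, the
    derivative of the pairing of two parallel fields V and W is the sum over
    l, i, j of xd_l V_i W_j times d_l g_ij minus the two Christoffel symbols of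
    the first kind [li, j] and [lj, i]; the latter add up to d_l g_ij. *)
Lemma parallel_pairing_derivative p x (xd V W dV dW : 'I_n -> R) : dom g p x ->
  let G := gram g p (chart g p x) in
  (forall k, dV k = - \sum_i \sum_j christoffel g p x k i j * xd i * V j) ->
  (forall k, dW k = - \sum_i \sum_j christoffel g p x k i j * xd i * W j) ->
  \sum_i \sum_j (V i * (G i j * dW j + W j * \sum_l xd l * dgram p x l i j) +
     G i j * W j * dV i) = 0.
Proof.
move=> px G hV hW.
have key U Z (dU : 'I_n -> R) :
    (forall k, dU k = - \sum_i \sum_j christoffel g p x k i j * xd i * U j) ->
    \sum_k \sum_m dU k * G k m * Z m = - \sum_i \sum_j \sum_m xd i * U j * Z m *
    (2^-1 * (dgram p x i j m + dgram p x j i m - dgram p x m i j)).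
  move=> hU.
  under eq_bigr => k _ do under eq_bigr => m _ do rewrite hU !mulNr.
  under eq_bigr => k _ do rewrite sumrN; rewrite sumrN; congr (- _).
  transitivity (\sum_k \sum_m \sum_i \sum_j xd i * U j * Z m *
      (christoffel g p x k i j * gram g p (chart g p x) k m)).
    apply: eq_bigr => k _; apply: eq_bigr => m _.
    rewrite !mulr_suml; apply: eq_bigr => i _.
    rewrite !mulr_suml; apply: eq_bigr => j _; ring.
  rewrite exchange_big/=.
  under eq_bigr => m _ do rewrite exchange_big/=.
  rewrite exchange_big/=; apply: eq_bigr => i _.
  under eq_bigr => m _ do rewrite exchange_big/=.
  rewrite exchange_big/=; apply: eq_bigr => j _.
  by apply: eq_bigr => m _; rewrite -mulr_sumr christoffel_first_kind.
under eq_bigr => i _ do under eq_bigr => j _ do rewrite mulrDr.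
under eq_bigr => i _ do rewrite !big_split/=.
rewrite !big_split/=.
have -> : \sum_i \sum_j V i * (G i j * dW j) = \sum_k \sum_m dW k * G k m * V m.
  rewrite exchange_big/=; apply: eq_bigr => i _; apply: eq_bigr => j _.
  by rewrite /G (gram_symE j i px); ring.
have -> : \sum_i \sum_j G i j * W j * dV i = \sum_k \sum_m dV k * G k m * W m.
  apply: eq_bigr => i _; apply: eq_bigr => j _; ring.
rewrite (key W V dW hW) (key V W dV hV).
have -> : \sum_i \sum_j V i * (W j * \sum_l xd l * dgram p x l i j) =
   \sum_l \sum_i \sum_j xd l * V i * W j * dgram p x l i j.
  rewrite [RHS]exchange_big/=; apply: eq_bigr => i _.
  rewrite [RHS]exchange_big/=; apply: eq_bigr => j _.
  by rewrite mulrA mulr_sumr; apply: eq_bigr => l _; ring.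
have -> : \sum_i \sum_j \sum_m xd i * W j * V m *
    (2^-1 * (dgram p x i j m + dgram p x j i m - dgram p x m i j)) =
  \sum_i \sum_j \sum_m xd i * V j * W m *
    (2^-1 * (dgram p x i m j + dgram p x m i j - dgram p x j i m)).
  apply: eq_bigr => i _; rewrite exchange_big/=; apply: eq_bigr => j _.
  by apply: eq_bigr => m _; ring.
rewrite addrAC -opprD addrC; apply/eqP; rewrite subr_eq0; apply/eqP.
rewrite -big_split/=; apply: eq_bigr => i _.
rewrite -big_split/=; apply: eq_bigr => j _.
rewrite -big_split/=; apply: eq_bigr => m _.
by rewrite (dgram_sym i m j px); field.
Qed.

Lemma derivable_inner_parallel c V W t : C1_at g c t ->
  parallel_at g c V t -> parallel_at g c W t ->
  is_derive t 1 (fun s => inner g (c s) (V s) (W s)) 0.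
Proof.
move=> [cc cd] pV pW; set p := c t.
have pc : dom g p (c t) by exact: dom_center.
have [dx _] := cd _ pc; have [dV hV] := pV _ pc; have [dW hW] := pW _ pc.
have E : \forall s \near t, (\sum_i \sum_j field_in g p c V s 0 i *
    gram g p (chart g p (c s)) i j * field_in g p c W s 0 j) =
    inner g (c s) (V s) (W s).
  near=> s; rewrite (@inner_in_chart _ _ _ g p)//; near: s; exact: near_dom.
apply: (near_eq_is_derive E).
have dE (U : R -> 'rV[R]_n) : covariant_derivative g p c U t = 0 ->
    forall k, derive1 (field_in g p c U) t 0 k =
   - \sum_i \sum_j christoffel g p (c t) k i j * derive1 (chart g p \o c) t 0 i *
     field_in g p c U t 0 j.
  move=> /rowP hU k; have := hU k; rewrite !mxE => /eqP; rewrite addr_eq0 => /eqP ->.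
  by [].
have Z := @parallel_pairing_derivative p (c t)
  (fun i => derive1 (chart g p \o c) t 0 i) (fun i => field_in g p c V t 0 i)
  (fun i => field_in g p c W t 0 i) (fun i => derive1 (field_in g p c V) t 0 i)
  (fun i => derive1 (field_in g p c W) t 0 i) pc (dE _ hV) (dE _ hW).
apply: is_derive_eq Z.
apply: is_derive_bigsum => i; apply: is_derive_bigsum => j.
have D1 := derive1_entry 0 i dV; have D2 := derive1_entry 0 j dW.
have D3 := is_derive_gram_along i j pc dx.
have D4 := is_deriveM (is_deriveM D1 D3) D2.
apply: is_derive_eq D4 _.
by rewrite /= /GRing.scale/= mulrfctE; ring.
Unshelve. all: by end_near. Qed.

End parallel.

(** * Curves on the unit interval *)

Section near01_theory.
Context {R : realType}.
Implicit Types (Q : R -> Prop) (h : R -> R).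

Lemma near01_and Q1 Q2 : near01 Q1 -> near01 Q2 -> near01 (fun t => Q1 t /\ Q2 t).
Proof.
move=> [e1 e10 H1] [e2 e20 H2]; exists (Num.min e1 e2); first by rewrite lt_min e10.
have m1 : Num.min e1 e2 <= e1 by rewrite ge_min lexx.
have m2 : Num.min e1 e2 <= e2 by rewrite ge_min lexx orbT.
move=> t /andP[t1 t2]; split; [apply: H1|apply: H2]; apply/andP; split; lra.
Qed.

Lemma near01_at Q t : near01 Q -> 0 <= t <= 1 -> Q t.
Proof. by move=> [e e0 H] /andP[t0 t1]; apply: H; apply/andP; split; lra. Qed.

Lemma near01_imply Q1 Q2 : (forall t, Q1 t -> Q2 t) -> near01 Q1 -> near01 Q2.
Proof. by move=> H [e e0 He]; exists e => // t /He; exact: H. Qed.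

Lemma near01_nbhs Q : near01 Q -> near01 (fun t => \forall s \near t, Q s).
Proof.
move=> [e e0 H]; exists e => // t te.
have : t \in `](- e), (1 + e)[ by rewrite in_itv.
move=> /near_in_itvoo; apply: filterS => s; rewrite in_itv/=; exact: H.
Qed.

(** The reparametrization s = a + b t maps the unit interval into itself; since
    b <= 1, it also maps each e-neighbourhood of it into itself. *)
Lemma near01_affine Q a b : 0 <= a -> 0 <= b -> a + b <= 1 -> near01 Q ->
  near01 (fun t => Q (a + b * t)).
Proof.
move=> a0 b0 ab [e e0 H]; exists e => // t /andP[t1 t2]; apply: H.
have [->|bn0] := eqVneq b 0; first by rewrite mul0r addr0; apply/andP; split; lra.
have bp : 0 < b by rewrite lt_neqAle eq_sym bn0.
have H1 : 0 < b * (t + e) by rewrite mulr_gt0//; lra.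
have H2 : 0 < b * (1 + e - t) by rewrite mulr_gt0//; lra.
have H3 : 0 <= e * (1 - b) by rewrite mulr_ge0//; lra.
apply/andP; split; lra.
Qed.

Lemma derive1_le0_nincr01 h : near01 (fun t => derivable h t 1) ->
  (forall t, 0 <= t <= 1 -> derive1 h t <= 0) ->
  forall t, 0 <= t <= 1 -> h t <= h 0.
Proof.
move=> dh dh0 t /andP[t0 t1].
have sub x : x \in `]0, 1[ -> 0 <= x <= 1.
  by rewrite in_itv/= => /andP[? ?]; apply/andP; split; exact: ltW.
apply: (@ler0_derive1_nincr R h 0 1) => //.
- by move=> x /sub; exact: (near01_at dh).
- by move=> x /sub; exact: dh0.
- apply: derivable_within_continuous => x; rewrite in_itv/=; exact: (near01_at dh).
Qed.

Lemma is_derive0_const01 h : near01 (fun t : R => is_derive t 1 h 0) ->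
  forall t, 0 <= t <= 1 -> h t = h 0.
Proof.
move=> dh t t01; apply/eqP; rewrite eq_le; apply/andP; split.
- apply: derive1_le0_nincr01 => //.
  + by apply: near01_imply dh => s [].
  + by move=> s /(near01_at dh)[_]; rewrite derive1E => ->.
- rewrite -lerN2; apply: (@derive1_le0_nincr01 (- h)) => //.
  + by apply: near01_imply dh => s [? _]; exact: derivableN.
  + move=> s /(near01_at dh)[? e]; rewrite derive1E deriveN// e oppr0//.
Qed.

Lemma derivable_affine (V : normedModType R) (F : R -> V) (a b t : R) :
  derivable F (a + b * t) 1 ->
  derivable (F \o (fun s => a + b * s)) t 1 /\
  derive1 (F \o (fun s => a + b * s)) t = b *: derive1 F (a + b * t).
Proof.
move=> dF; have dA : is_derive t 1 (fun s : R => a + b * s) b.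
  have D := is_deriveD (is_derive_cst a t 1)
    (is_deriveM (is_derive_cst b t 1) (is_derive_id t (1 : R))).
  by apply: is_derive_eq D _; rewrite scaler0 addr0 add0r /GRing.scale/= mulr1.
have dF' : differentiable F (a + b * t) by exact/derivable1_diffP.
split; first exact: (derivable_compose (f := fun s : R => a + b * s)).
rewrite (derive1_compose (f := fun s : R => a + b * s))//.
rewrite derive1E; have -> : 'D_1 (fun s : R => a + b * s) t = b by case: dA.
by rewrite diff1E.
Qed.

End near01_theory.

(** * The inner product, parallel fields and geodesics *)

Section geodesics.
Context {R : realType} {n : nat} {M : ptopologicalType}.
Variable g : riemannian R n M.
Implicit Types (x y p q : M) (c : R -> M) (u v w : 'rV[R]_n).

Lemma innerC x u v : inner g x u v = inner g x v u.
Proof.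
rewrite /inner !mulmx_form exchange_big/=; apply: eq_bigr => i _.
apply: eq_bigr => j _; rewrite (gram_symE j i (dom_center g x)); ring.
Qed.

Lemma innerDl x u v w : inner g x (u + v) w = inner g x u w + inner g x v w.
Proof. by rewrite /inner !mulmxDl mxE. Qed.

Lemma innerZl x a u v : inner g x (a *: u) v = a * inner g x u v.
Proof. by rewrite /inner -!scalemxAl mxE. Qed.

Lemma innerNl x u v : inner g x (- u) v = - inner g x u v.
Proof. by rewrite -scaleN1r innerZl mulN1r. Qed.

Lemma innerDr x u v w : inner g x u (v + w) = inner g x u v + inner g x u w.
Proof. by rewrite innerC innerDl !(innerC _ u). Qed.

Lemma innerZr x a u v : inner g x u (a *: v) = a * inner g x u v.
Proof. by rewrite innerC innerZl innerC. Qed.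

Lemma innerNr x u v : inner g x u (- v) = - inner g x u v.
Proof. by rewrite innerC innerNl innerC. Qed.

Lemma inner0l x v : inner g x 0 v = 0.
Proof. by rewrite -(scale0r 0) innerZl mul0r. Qed.

Lemma inner_ge0 x u : 0 <= inner g x u u.
Proof.
have [->|u0] := eqVneq u 0; first by rewrite inner0l.
by rewrite ltW// /inner; apply: gram_posdef => //; exact: dom_center.
Qed.

Lemma inner_eq0 x u : inner g x u u = 0 -> u = 0.
Proof.
move=> u0; apply/eqP/negPn/negP => n0.
by have := gram_posdef (dom_center g x) n0; rewrite -/(inner g x u u) u0 ltxx.
Qed.

Lemma tnorm_ge0 x u : 0 <= tnorm g x u.
Proof. exact: sqrtr_ge0. Qed.

Lemma tnorm_sqr x u : tnorm g x u ^+ 2 = inner g x u u.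
Proof. by rewrite sqr_sqrtr// inner_ge0. Qed.

Lemma tnormN x u : tnorm g x (- u) = tnorm g x u.
Proof. by rewrite /tnorm innerNl innerNr opprK. Qed.

Lemma tnormZ x a u : 0 <= a -> tnorm g x (a *: u) = a * tnorm g x u.
Proof.
move=> a0; rewrite /tnorm innerZl innerZr mulrA sqrtrM ?mulr_ge0//.
by rewrite -expr2 sqrtr_sqr ger0_norm.
Qed.

(** Cauchy-Schwarz, from the non-negativity of the square of |u| v - |v| u. *)
Lemma inner_tnorm_le x u v : inner g x u v <= tnorm g x u * tnorm g x v.
Proof.
have [u0|u0] := eqVneq (tnorm g x u) 0.
  have := tnorm_sqr x u; rewrite u0 expr0n/= => /esym/inner_eq0 ->.
  by rewrite inner0l mul0r.
have up : 0 < tnorm g x u by rewrite lt_neqAle eq_sym u0 tnorm_ge0.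
have [v0|v0] := eqVneq (tnorm g x v) 0.
  have := tnorm_sqr x v; rewrite v0 expr0n/= => /esym/inner_eq0 ->.
  by rewrite innerC inner0l mulr0.
have vp : 0 < tnorm g x v by rewrite lt_neqAle eq_sym v0 tnorm_ge0.
have := inner_ge0 x (tnorm g x v *: u - tnorm g x u *: v).
rewrite !(innerDl, innerDr, innerNl, innerNr, innerZl, innerZr) (innerC x v u).
rewrite -!tnorm_sqr; set a := tnorm g x u in up *; set b := tnorm g x v in vp *.
set i := inner g x u v => H.
have : 0 <= 2 * (a * b) * (a * b - i) by move: H; nra.
by rewrite pmulr_rge0 ?mulr_gt0// subr_ge0.
Qed.

(** Applied to a field and the velocity of a geodesic this makes parallel
    transport isometric; applied to the velocity twice it gives the constant
    speed of geodesics. *)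
Lemma inner_parallel_cst c V W : near01 (C1_at g c) ->
  near01 (parallel_at g c V) -> near01 (parallel_at g c W) ->
  forall t, 0 <= t <= 1 -> inner g (c t) (V t) (W t) = inner g (c 0) (V 0) (W 0).
Proof.
move=> cC pV pW t t01.
apply: (@is_derive0_const01 R (fun s => inner g (c s) (V s) (W s))) => //.
apply: near01_imply (near01_and cC (near01_and pV pW)) => s [? [? ?]].
exact: derivable_inner_parallel.
Qed.

Lemma geodesic_speed c t : geodesic g c -> 0 <= t <= 1 ->
  tnorm g (c t) (velocity g c t) = tnorm g (c 0) (velocity g c 0).
Proof.
by move=> [cC cP] t01; rewrite /tnorm; congr Num.sqrt; exact: inner_parallel_cst.
Qed.

Section affine_reparametrization.
Variables (c : R -> M) (a b : R).
Hypotheses (a0 : 0 <= a) (b0 : 0 <= b) (ab : a + b <= 1).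
Let c' (t : R) := c (a + b * t).

Lemma continuous_affine : continuous (fun s : R => a + b * s).
Proof.
by move=> s; apply: cvgD; [exact: cvg_cst|apply: cvgM; [exact: cvg_cst|exact: cvg_id]].
Qed.

Lemma C1_affine : near01 (C1_at g c) -> near01 (C1_at g c').
Proof.
move=> cC; have := near01_affine a0 b0 ab (near01_nbhs cC).
apply: near01_imply => t nt.
have [cc cd] := nbhs_singleton nt.
have ct : {for t, continuous c'}.
  by apply: (@continuous_comp _ _ _ (fun s : R => a + b * s) c); first exact: continuous_affine.
split; [exact: ct | move=> p pc]; have [dp cdp] := cd p pc.
have [dp' _] := derivable_affine dp.
split; first exact: dp'.
have E : {near t, (fun s => b *: derive1 (chart g p \o c) (a + b * s)) =1
                 derive1 (chart g p \o c')}.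
  have N1 := near_dom ct pc.
  have N2 : \forall s \near t, C1_at g c (a + b * s).
    exact: (@continuous_affine t _ nt).
  near=> s.
  have [_ /(_ p) cs] : C1_at g c (a + b * s) by near: s.
  have /cs[ds _] : dom g p (c (a + b * s)) by near: s.
  by have [_ <-] := derivable_affine ds.
have := nbhs_singleton E; rewrite /prop_for /continuous_at => <-.
apply: cvg_trans; first exact: near_eq_cvg E.
have := (@continuous_comp _ _ _ (fun s : R => a + b * s)
   (derive1 (chart g p \o c)) t (@continuous_affine t) cdp).
by move=> /(cvgZl_tmp (k := b)).
Unshelve. all: by end_near. Qed.

Lemma velocity_affine t : C1_at g c (a + b * t) ->
  velocity g c' t = b *: velocity g c (a + b * t).
Proof.
move=> [_ /(_ _ (dom_center g _))[dp _]].
by have [_ <-] := derivable_affine dp.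
Qed.

End affine_reparametrization.

End geodesics.

(** * Minimizing geodesics and the descent lemma *)

Lemma zero_in01 (R : realType) : 0 <= (0 : R) <= 1.
Proof. by rewrite lexx ler01. Qed.

Lemma one_in01 (R : realType) : 0 <= (1 : R) <= 1.
Proof. by rewrite lexx ler01. Qed.

Section minimizing_geodesics.
Context {R : realType} {n : nat} {M : ptopologicalType}.
Variable g : riemannian R n M.
Implicit Types (x y z p q : M) (c : R -> M) (u v w : 'rV[R]_n).

(** Under the reparametrization the acceleration and the Christoffel term, in a
    fixed chart, are both multiplied by b * b. *)
Lemma geodesic_affine c a b : 0 <= a -> 0 <= b -> a + b <= 1 ->
  geodesic g c -> geodesic g (fun t => c (a + b * t)).
Proof.
move=> a0 b0 ab [cC cP]; split; first exact: C1_affine.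
have := near01_and (near01_affine a0 b0 ab (near01_nbhs cC)) (near01_affine a0 b0 ab cP).
apply: near01_imply => t [nt ct] p pc.
set F := field_in g p c (velocity g c).
have [dF cF] := ct p pc.
have [dF' eF'] := derivable_affine dF.
have Cnear : \forall s \near t, C1_at g c (a + b * s) by exact: (@continuous_affine R a b t _ nt).
have E : {near t, b \*: (F \o (fun s => a + b * s)) =1
    field_in g p (fun t => c (a + b * t)) (velocity g (fun t => c (a + b * t)))}.
  near=> s.
  rewrite /field_in velocity_affine; last by near: s.
  by rewrite /tcoord linearZ.
have dbF : derivable (b \*: (F \o (fun s => a + b * s))) t 1 by exact: derivableZ.
split; first exact: near_eq_derivable E dbF.
set F' := field_in g p (fun t => c (a + b * t)) _ in E *.
have e1 : derive1 F' t = b *: (b *: derive1 F (a + b * t)).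
  apply: etrans (esym (near_eq_derive1 E)) _.
  by rewrite derive1E (deriveZ b dF') -derive1E eF'.
have [_ /(_ p pc)[dc _]] := nbhs_singleton nt.
have [_ e2] := derivable_affine dc.
have e3 : F' t = b *: F (a + b * t) by rewrite -(nbhs_singleton E).
rewrite /covariant_derivative -/F' e1 e3.
rewrite (_ : derive1 (chart g p \o (fun t => c (a + b * t))) t =
  b *: derive1 (chart g p \o c) (a + b * t)); last exact: e2.
apply: (@eq_trans _ _ ((b * b) *: covariant_derivative g p c (velocity g c) (a + b * t))).
  rewrite /covariant_derivative scalerDr !scalerA; congr (_ + _).
  apply/rowP => k; rewrite !mxE mulr_sumr; apply: eq_bigr => i _.
  rewrite mulr_sumr; apply: eq_bigr => j _.
  by rewrite !mxE /F; ring.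
by rewrite cF scaler0.
Unshelve. all: by end_near. Qed.

Lemma geodesic_curve_length c : geodesic g c ->
  curve_length g c = tnorm g (c 0) (velocity g c 0).
Proof.
move=> gc; rewrite /curve_length.
rewrite (@eq_Rintegral _ _ _ _ _ (cst (tnorm g (c 0) (velocity g c 0)))).
  rewrite Rintegral_cst//= lebesgue_measure_itv/= lte_fin ltr01/=.
  by rewrite subr0 mulr1.
by move=> t; rewrite inE/= in_itv/=; exact: geodesic_speed.
Qed.

Lemma path_length_ge0 x y l : path_length g x y l -> 0 <= l.
Proof.
elim=> // c z m _ _ m0; rewrite addr_ge0// /curve_length.
by apply: Rintegral_ge0 => t _; exact: tnorm_ge0.
Qed.

Lemma path_length_cat x y z l m :
  path_length g x y l -> path_length g y z m -> path_length g x z (l + m).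
Proof.
elim=> [x'|c y' l' cC _ IH] H; first by rewrite add0r.
by rewrite -addrA; apply: path_cons => //; exact: IH.
Qed.

Lemma path_length_curve c : near01 (C1_at g c) ->
  path_length g (c 0) (c 1) (curve_length g c).
Proof. by move=> cC; rewrite -[curve_length _ _]addr0; apply: path_cons => //; exact: path_nil. Qed.

Lemma dist_le x y l : path_length g x y l -> dist g x y <= l.
Proof.
move=> xyl; apply: ge_inf => //; exists 0 => m; exact: path_length_ge0.
Qed.

Lemma dist_ge x y l m : path_length g x y m ->
  (forall k, path_length g x y k -> l <= k) -> l <= dist g x y.
Proof. by move=> xym H; apply: lb_le_inf; [exists m|exact: H]. Qed.

Lemma distxx_le0 x : dist g x x <= 0.
Proof. by apply: dist_le; exact: path_nil. Qed.

Section geodesic_segment.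
Variables (c : R -> M) (t : R).
Hypotheses (gc : geodesic g c) (t0 : 0 <= t) (t1 : t <= 1).
Hypothesis c_min : tnorm g (c 0) (velocity g c 0) = dist g (c 0) (c 1).
Let l := tnorm g (c 0) (velocity g c 0).

Lemma velocity_segment a b s : 0 <= a -> 0 <= b -> a + b <= 1 -> 0 <= s <= 1 ->
  velocity g (fun s => c (a + b * s)) s = b *: velocity g c (a + b * s).
Proof.
move=> a0 b0 ab s01; apply: velocity_affine; case: gc => cC _.
exact: (near01_at (near01_affine a0 b0 ab cC)).
Qed.

Lemma curve_length_segment a b : 0 <= a -> 0 <= b -> a + b <= 1 ->
  curve_length g (fun s => c (a + b * s)) = b * l.
Proof.
move=> a0 b0 ab; rewrite geodesic_curve_length; last exact: geodesic_affine.
rewrite (velocity_segment a0 b0 ab (zero_in01 R)) (tnormZ _ _ _ b0) mulr0 addr0.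
by rewrite (geodesic_speed gc)// a0/=; lra.
Qed.

Lemma path_segment a b : 0 <= a -> 0 <= b -> a + b <= 1 ->
  path_length g (c a) (c (a + b)) (b * l).
Proof.
move=> a0 b0 ab; rewrite -(curve_length_segment a0 b0 ab).
have := path_length_curve (proj1 (geodesic_affine a0 b0 ab gc)).
by rewrite mulr0 addr0 mulr1.
Qed.

(** If c minimizes from c 0 to c 1, so does its initial segment: a path from c 0
    to c t shorter than t * l would, continued along c, give a path from c 0 to
    c 1 shorter than l. *)
Lemma dist_segment : dist g (c 0) (c t) = t * l.
Proof.
have P1 : path_length g (c 0) (c t) (t * l).
  by have := @path_segment 0 t (lexx 0) t0; rewrite add0r; exact.
have P2 : path_length g (c t) (c 1) ((1 - t) * l).
  have := @path_segment t (1 - t) t0; rewrite (addrC t) subrK; apply=> //; rewrite subr_ge0; exact: t1.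
apply/eqP; rewrite eq_le; apply/andP; split; first exact: dist_le P1.
apply: (dist_ge P1) => k Pk.
have := dist_le (path_length_cat Pk P2); rewrite -c_min -/l; lra.
Qed.

(** With the uniqueness of the inverse exponential map, the last clause identifies
    Log (c 0) (c t) with t times the initial velocity. *)
Lemma geodesic_initial_segment :
  [/\ geodesic g (fun s => c (t * s)), c (t * 0) = c 0,
   (forall s, 0 <= s <= 1 -> velocity g (fun s => c (t * s)) s = t *: velocity g c (t * s)),
    c (t * 1) = c t &
    tnorm g (c 0) (t *: velocity g c 0) = dist g (c 0) (c t)].
Proof.
have := @geodesic_affine c 0 t (lexx 0) t0; rewrite add0r => /(_ t1 gc) G.
have E : (fun s => c (0 + t * s)) = (fun s => c (t * s)).
  by apply/funext => s; rewrite add0r.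
split; rewrite ?mulr0 ?mulr1//; first by rewrite -E.
  move=> s s01; have := @velocity_segment 0 t s (lexx 0) t0; rewrite !add0r E.
  exact.
by rewrite tnormZ// dist_segment.
Qed.

End geodesic_segment.

Section descent.
Variables (Log : M -> M -> 'rV[R]_n) (hLog : inverse_exp g Log).
Variables (Gamma : M -> M -> 'rV[R]_n -> 'rV[R]_n).
Hypothesis hGamma : parallel_transport g Log Gamma.

Lemma Log_norm x y : tnorm g x (Log x y) = dist g x y.
Proof. by have [] := hLog x y. Qed.

Lemma Logxx x : Log x x = 0.
Proof.
apply: (@inner_eq0 _ _ _ g x); rewrite -tnorm_sqr Log_norm.
apply/eqP; rewrite sqrf_eq0 eq_le distxx_le0/= -Log_norm; exact: tnorm_ge0.
Qed.

Lemma geodesic_between_exists x y : exists c, geodesic_between g Log x y c.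
Proof. by have [[c [? ? ? ?]] _ _] := hLog x y; exists c. Qed.

(** The gradient is dual to the differential: the inverse Gram matrix in its
    definition cancels the Gram matrix of the inner product. *)
Lemma inner_grad (f : M -> R) x v : mdifferentiable g f x ->
  inner g x (grad g f x) v = 'd (f \o chart_inv g x) (chart g x x) v.
Proof.
move=> df; rewrite /inner /grad mulmxKV; last by apply: gram_unit; exact: dom_center.
rewrite [in RHS](row_sum_delta v) linear_sum mxE; apply: eq_bigr => i _.
by rewrite linearZ/= !mxE deriveE// mulrC.
Qed.

Lemma derive_along c (f : M -> R) t : C1_at g c t -> mdifferentiable g f (c t) ->
  derivable (f \o c) t 1 /\
  derive1 (f \o c) t = inner g (c t) (grad g f (c t)) (velocity g c t).
Proof.
move=> [cc cd] df; have pc := dom_center g (c t).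
have [dx _] := cd _ pc.
have E : {near t, (f \o chart_inv g (c t)) \o (chart g (c t) \o c) =1 f \o c}.
  by near=> s; rewrite /= chartK//; near: s; exact: near_dom.
split; first by apply: near_eq_derivable E _; exact: derivable_compose.
by rewrite -(near_eq_derive1 E) derive1_compose// inner_grad.
Unshelve. all: by end_near. Qed.

(** Along the geodesic c, f \o c has derivative <grad f, c'> at t. Compare it with
    its value at 0: parallel transport from x to c t is along c itself and maps
    the initial velocity to c' t, so L-smoothness bounds the difference by
    L * (t l) * l, where l is the length of c. Integrating from 0 to eta would
    give L * l ^ 2 * eta ^ 2 / 2; the factor 1/2 is immaterial for the rate, and
    the absolute value covers a negative L. *)
Lemma smooth_descent (L D : R) (f : M -> R) x y c eta :
  L_smooth g Gamma L f -> geodesic_between g Log x y c -> 0 <= eta <= 1 ->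
  dist g x y <= D ->
  f (c eta) <= f x + eta * inner g x (grad g f x) (Log x y) +
    eta ^+ 2 * (`|L| * D ^+ 2).
Proof.
move=> [df Lf] [gc c0 vc c1] eta01 distD.
have cmin : tnorm g (c 0) (velocity g c 0) = dist g (c 0) (c 1).
  by rewrite c0 vc c1 Log_norm.
set l := dist g x y in distD.
have l0 : 0 <= l by rewrite /l -Log_norm; exact: tnorm_ge0.
have speed t : 0 <= t <= 1 -> tnorm g (c t) (velocity g c t) = l.
  by move=> t01; rewrite geodesic_speed// cmin c0 c1.
set A := inner g x (grad g f x) (Log x y).
have key t : 0 <= t <= 1 ->
    inner g (c t) (grad g f (c t)) (velocity g c t) <= A + t * (`|L| * l ^+ 2).
  move=> /andP[t0 t1].
  have [->|tn0] := eqVneq t 0; first by rewrite c0 vc mul0r addr0.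
  have tp : 0 < t by rewrite lt_neqAle eq_sym tn0.
  have [gs _ vs cs1 ns] := geodesic_initial_segment gc t0 t1 cmin.
  have vs0 := vs 0 (zero_in01 R); rewrite mulr0 in vs0.
  have vs1 := vs 1 (one_in01 R); rewrite mulr1 in vs1.
  have gb : geodesic_between g Log x (c t) (fun s => c (t * s)).
    split; [exact: gs|by rewrite mulr0| |by rewrite mulr1].
    have [_ _] := hLog x (c t); rewrite vs0; apply; last by rewrite -c0; exact: ns.
    by exists (fun s => c (t * s)); split; [exact: gs|rewrite mulr0|rewrite vs0 |rewrite mulr1].
  have [V [pV V0 V1]] := hGamma gb (grad g f x).
  have [gsC gsP] := gs.
  have := inner_parallel_cst gsC pV gsP (one_in01 R).
  rewrite V0 V1 mulr0 mulr1 vs0 vs1 !innerZr => /(mulfI (lt0r_neq0 tp)) iso.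
  (* Transport is isometric, so only the defect of grad f from being parallel
     contributes. *)
  have -> : grad g f (c t) = (grad g f (c t) - Gamma x (c t) (grad g f x)) +
     Gamma x (c t) (grad g f x) by rewrite subrK.
  rewrite innerDl iso c0 vc -/A addrC lerD2l.
  apply: le_trans (inner_tnorm_le _ _ _ _) _; rewrite (speed t) ?t0//.
  have := Lf x (c t); rewrite -{3}c0 dist_segment// cmin c0 c1 -/l => H.
  apply: le_trans (ler_wpM2r l0 H) _.
  rewrite (_ : L * (t * l) * l = t * (L * l ^+ 2)); last by ring.
  by rewrite ler_wpM2l// ler_wpM2r ?sqr_ge0// ler_norm.
pose B := `|L| * l ^+ 2.
have B0 : 0 <= B by rewrite mulr_ge0// sqr_ge0.
(* f \o c has derivative at most A + B * t, and A * t + B * (t * t) has derivative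
   A + 2 * B * t. *)
pose h (t : R) := f (c t) - (A * t + B * (t * t)).
have dpoly (t : R) : is_derive t 1 (fun t : R => A * t + B * (t * t)) (A + B * (t + t)).
  have I := is_derive_id t (1 : R).
  have D1 := is_deriveD (is_deriveM (is_derive_cst A t 1) I)
    (is_deriveM (is_derive_cst B t 1) (is_deriveM I I)).
  by apply: is_derive_eq D1 _; rewrite /GRing.scale/=; ring.
have cC : near01 (C1_at g c) by case: gc.
have : h eta <= h 0.
  apply: derive1_le0_nincr01 => //.
    apply: near01_imply cC => t Ct.
    have [d1 _] := derive_along Ct (df (c t)); exact: derivableB.
  move=> t t01; have Ct := near01_at cC t01.
  have [d1 e1] := derive_along Ct (df (c t)).
  have [d2 e2] := dpoly t.
  rewrite derive1E (_ : h = (f \o c) - (fun t => A * t + B * (t * t)))// deriveB//.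
  rewrite e2 -derive1E e1 subr_le0; apply: le_trans (key _ t01) _.
  by rewrite -/B; move/andP: t01 => [? ?]; nra.
rewrite /h c0 !mulr0 addr0 subr0 lerBlDr => /le_trans; apply.
rewrite -addrA lerD2l mulrC lerD2l mulrC -expr2 ler_wpM2l ?sqr_ge0// /B.
by rewrite ler_wpM2l// lerXn2r// ?nnegrE//; exact: le_trans distD.
Qed.

End descent.
End minimizing_geodesics.

(** * The distance is bounded on compact sets *)

Section lower_integral.
Import HBNNSimple.

(** The integral of a non-negative function is the supremum over the simple
    functions below it, hence monotone even where neither function is known to be
    measurable. The Frank-Wolfe gap, a supremum over an uncountable set, is bounded in
    mean through this lemma. *)
Lemma ge0_le_integral_nonmeasurable d (T : measurableType d) (R : realType)
    (m : {measure set T -> \bar R}) (D : set T) (f h : T -> \bar R) :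
  (forall x, D x -> 0 <= f x)%E -> (forall x, D x -> f x <= h x)%E ->
  (\int[m]_(x in D) f x <= \int[m]_(x in D) h x)%E.
Proof.
move=> f0 fh.
rewrite (integral_mkcond D f) (integral_mkcond D h) !ge0_integralTE.
- apply: ereal_sup_le => _ [k kf <-]; exists k => // x; apply: le_trans (kf x) _; apply: lee_restrict => y; exact: fh.
- by apply: erestrict_ge0 => x Dx; apply: le_trans (fh x Dx); exact: f0.
- exact: erestrict_ge0.
Qed.

End lower_integral.

Lemma compact_finite_nbhs_cover (T : ptopologicalType) (X : set T) (U : T -> set T) :
  compact X -> (forall p, nbhs p (U p)) ->
  exists s : seq T, forall x, X x -> exists2 p, p \in s & U p x.
Proof.
rewrite compact_cover => cX nU.
have [||s _ Xs] := cX T setT (fun p => interior (U p)).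
- by move=> p _; exact: open_interior.
- by move=> x Xx; exists x => //; exact: nU.
exists (finmap.enum_fset s) => x /Xs[p ps Up]; exists p => //; exact: interior_subset.
Qed.

Lemma entry_le_norm (R : realType) m k (A : 'M[R]_(m, k)) i j : `|A i j| <= `|A|.
Proof. by rewrite [leRHS]/Num.Def.normr/= mx_normrE; exact: (le_bigmax _ _ (i, j)). Qed.

Section diameter.
Context {R : realType} {n : nat} {M : ptopologicalType}.
Variable g : riemannian R n M.
Implicit Types (x y z p q : M) (c : R -> M) (u v w : 'rV[R]_n).

Lemma form_le_norm (w : 'rV[R]_n) (G : 'M[R]_n) :
  (w *m G *m w^T) 0 0 <= n%:R ^+ 2 * (`|w| ^+ 2 * `|G|).
Proof.
rewrite mulmx_form.
apply: (@le_trans _ _ (\sum_(i < n) \sum_(j < n) (`|w| ^+ 2 * `|G|))).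
  apply: ler_sum => i _; apply: ler_sum => j _.
  apply: le_trans (ler_norm _) _; rewrite !normrM mulrAC expr2.
  apply: ler_pM; rewrite ?mulr_ge0 ?entry_le_norm//.
  by apply: ler_pM; rewrite ?entry_le_norm.
by rewrite !sumr_const !card_ord -mulrnA -[_ *+ (n * n)]mulr_natl natrM expr2.
Qed.

(** The chart segment from u to u + w is an admissible path, and its speed is
    controlled by the Gram matrix. The segment is assumed to stay in the chart for
    -1 < t < 2, since curves are required to be C^1 beyond the end points. *)
Section chart_segment.
Variables (p : M) (u w : 'rV[R]_n) (K : R).
Let lam (t : R) := u + t *: w.
Let c (t : R) := chart_inv g p (lam t).
Hypothesis lam_cod : forall t : R, - 1 < t < 1 + 1 -> (chart g p @` dom g p) (lam t).
Hypothesis K0 : 0 <= K.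
Hypothesis gram_le : forall t : R, - 1 < t < 1 + 1 ->
  (w *m gram g p (lam t) *m w^T) 0 0 <= K ^+ 2.

Let c_dom (t : R) : - 1 < t < 1 + 1 -> dom g p (c t) /\ chart g p (c t) = lam t.
Proof.
move=> t01; rewrite /c; have [x px <-] := lam_cod t01.
by rewrite chartK.
Qed.

Let lam_derive t : derivable lam t 1 /\ derive1 lam t = w.
Proof.
have L : is_diff t lam (0 + ( *:%R ^~ w : R -> 'rV[R]_n)).
  exact: (@is_diffD _ _ _ (cst u) ( *:%R ^~ w : R -> 'rV[R]_n)).
have [dl el] := L; split; first exact/derivable1_diffP.
by rewrite derive1E' // el /= add0r scale1r.
Qed.

Let lam_continuous : continuous lam.
Proof.
move=> t; apply: differentiable_continuous; apply/derivable1_diffP.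
by have [] := lam_derive t.
Qed.

Let c_continuous (t : R) : - 1 < t < 1 + 1 -> {for t, continuous c}.
Proof.
move=> t01; have [ct ect] := c_dom t01.
apply: (@continuous_comp _ _ _ lam (chart_inv g p)); first exact: lam_continuous.
rewrite -ect; exact: chart_inv_continuous.
Qed.

Let near_seg (t : R) : - 1 < t < 1 + 1 -> \forall s \near t, - 1 < s < 1 + 1.
Proof.
move=> t01; have : t \in `](- 1), (1 + 1)[ by rewrite in_itv.
by move=> /near_in_itvoo; apply: filterS => s; rewrite in_itv.
Qed.

Let derive_chart q (t : R) : - 1 < t < 1 + 1 -> dom g q (c t) ->
  derivable (chart g q \o c) t 1 /\
  derive1 (chart g q \o c) t = tcoord g p q (c t) w.
Proof.
move=> t01 qc; have [pc ec] := c_dom t01.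
have [dl el] := lam_derive t.
have dT : differentiable (chart g q \o chart_inv g p) (lam t).
  by rewrite -ec; exact: transition_differentiable.
split; first exact: (derivable_compose dl dT).
rewrite (_ : chart g q \o c = (chart g q \o chart_inv g p) \o lam)//.
by rewrite (derive1_compose dl dT) el /tcoord ec.
Qed.

Let c_C1 : near01 (C1_at g c).
Proof.
exists (1 : R) => // t t01; split; first exact: c_continuous.
move=> q qc; have [dq eq] := derive_chart t01 qc; split; first exact: dq.
have [pc ec] := c_dom t01.
have E : {near t, (fun s => 'D_w (chart g q \o chart_inv g p) (lam s)) =1
                 derive1 (chart g q \o c)}.
  have N1 := near_dom (c_continuous t01) qc; have N2 := near_seg t01.
  near=> s.
  have s01 : - 1 < s < 1 + 1 by near: s.
  have qs : dom g q (c s) by near: s.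
  have [ps es] := c_dom s01.
  have [_ ->] := derive_chart s01 qs.
  rewrite /tcoord -es; apply: deriveE; exact: transition_differentiable.
have := nbhs_singleton E; rewrite /prop_for /continuous_at => <-.
apply: cvg_trans; first exact: near_eq_cvg E.
have [_ /(_ w) H] := @transition_smooth _ _ _ g p q 1%N.
have Hc : {for lam t, continuous ('D_w (chart g q \o chart_inv g p))}.
  by apply: H; exists (c t).
exact: (@continuous_comp _ _ _ lam _ t (lam_continuous (x := t)) Hc).
Unshelve. all: by end_near. Qed.

Lemma chart_segment_path : exists2 l, l <= K &
  path_length g (chart_inv g p u) (chart_inv g p (u + w)) l.
Proof.
exists (curve_length g c); last first.
  have := path_length_curve c_C1; rewrite /c /lam scale0r addr0 scale1r.
  exact.
have speed (t : R) : - 1 < t < 1 + 1 -> tnorm g (c t) (velocity g c t) <= K.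
  move=> t01; have [pc ec] := c_dom t01.
  have [_ v] := derive_chart t01 (dom_center g _).
  rewrite /tnorm /velocity v /inner gram_compat//; last exact: dom_center.
  by rewrite -[leRHS]ger0_norm// -sqrtr_sqr ler_wsqrtr// ec gram_le.
have mu01 : (lebesgue_measure (`[0%R, 1%R] : set R) = 1%:E)%E.
  by rewrite lebesgue_measure_itv/= lte_fin ltr01 -EFinB subr0.
rewrite /curve_length /Rintegral.
have -> : K = fine (\int[lebesgue_measure]_(t in `[0%R, 1%R] : set R) K%:E)%E.
  by rewrite integral_cst//= mu01 mule1.
set I := (\int[_]_(t in _) (tnorm _ _ _)%:E)%E.
have I0 : (0 <= I)%E.
  by apply: integral_ge0 => t _; rewrite lee_fin tnorm_ge0.
have IK : (I <= \int[lebesgue_measure]_(t in `[0%R, 1%R] : set R) K%:E)%E.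
  apply: ge0_le_integral_nonmeasurable => t; first by rewrite lee_fin tnorm_ge0.
  rewrite /= in_itv/= => /andP[t0 t1]; rewrite lee_fin speed//; apply/andP; split; lra.
apply: fine_le => //.
  rewrite ge0_fin_numE//; apply: le_lt_trans IK _.
  by rewrite integral_cst//= mu01 mule1 ltry.
by rewrite integral_cst//= mu01 mule1.
Qed.

End chart_segment.

(** Points whose coordinates lie within r / 3 of those of p are joined to p by chart
    segments: extended to -1 < t < 2, these stay in the ball of radius r, on which
    the Gram matrix is bounded. *)
Lemma locally_bounded_dist p : exists K, nbhs p [set x |
  (exists2 l, l <= K & path_length g p x l) /\
  (exists2 l, l <= K & path_length g x p l)].
Proof.
set a := chart g p p.
have pp := dom_center g p.
have cG : {for a, continuous (gram g p)}.
  by apply: differentiable_continuous; exact: gram_differentiable.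
set B := `|gram g p a| + 1.
have N1 : \forall z \near a, `|gram g p z| <= B.
  have /cvgrPdist_lt/(_ 1 ltr01) := cG; apply: filterS => z H.
  rewrite /B -lerBlDl; apply: le_trans (lerB_dist _ _) _.
  by rewrite distrC ltW.
have N2 := nbhs_cod pp.
have : nbhs a [set z : 'rV[R]_n | `|gram g p z| <= B /\ (chart g p @` dom g p) z].
  exact: filterI.
move=> /nbhs_ballP[r /= r0 Hr].
pose K := n%:R ^+ 2 * (r ^+ 2 * B) + 1.
have B0 : 0 <= B by rewrite addr_ge0.
have K1 : 1 <= K by rewrite lerDr !mulr_ge0// ltW.
have K0 : 0 <= K by lra.
exists K; have N3 : \forall x \near p, `|chart g p x - a| < r / 3.
  have /cvgrPdist_lt/(_ (r / 3)) := chart_continuous pp.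
  rewrite divr_gt0// => /(_ isT); apply: filterS => x; by rewrite distrC.
have N4 := nbhs_dom pp.
near=> x.
have px : dom g p x by near: x.
have dx : `|chart g p x - a| < r / 3 by near: x.
have inball (s : R) (z : 'rV[R]_n) : `|s| <= 2 -> z = a + s *: (chart g p x - a) -> ball a r z.
  move=> s2 ->; rewrite -ball_normE/= opprD addrA subrr add0r normrN normrZ.
  by apply: le_lt_trans (ler_wpM2r (normr_ge0 _) s2) _; lra.
have gramK (z w : 'rV[R]_n) : ball a r z -> `|w| <= r ->
    (w *m gram g p z *m w^T) 0 0 <= K ^+ 2.
  move=> /Hr[Bz _] wr; apply: le_trans (form_le_norm _ _) _.
  apply: (@le_trans _ _ K); last by rewrite expr2 ler_peMr.
  apply: (@le_trans _ _ (n%:R ^+ 2 * (r ^+ 2 * B))); last by rewrite /K lerDl.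
  rewrite ler_wpM2l ?sqr_ge0//; apply: ler_pM; rewrite ?sqr_ge0//.
  by rewrite lerXn2r ?nnegrE// ltW.
have wr : `|chart g p x - a| <= r by apply: ltW; apply: lt_trans dx _; lra.
have abs2 (t : R) : - 1 < t < 1 + 1 -> `|t| <= 2 /\ `|1 - t| <= 2.
  by move=> /andP[t1 t2]; rewrite !ler_norml; split; apply/andP; split; lra.
have E (t : R) : chart g p x + t *: (a - chart g p x) = a + (1 - t) *: (chart g p x - a).
  by rewrite scalerBl scale1r addrA [a + (_ - a)]addrC subrK -scalerN opprB.
split.
- have H1 (t : R) : - 1 < t < 1 + 1 -> ball a r (a + t *: (chart g p x - a)).
    by move=> /abs2[t2 _]; exact: inball t2 erefl.
  have [l lK] := chart_segment_path (fun t t01 => (Hr _ (H1 t t01)).2) K0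
    (fun t t01 => gramK _ _ (H1 t t01) wr).
  by rewrite [a + _]addrC subrK !chartK// => H; exists l.
- have H1 (t : R) : - 1 < t < 1 + 1 -> ball a r (chart g p x + t *: (a - chart g p x)).
    by move=> /abs2[_ t2]; exact: inball t2 (E t).
  rewrite distrC in wr.
  have [l lK] := chart_segment_path (fun t t01 => (Hr _ (H1 t t01)).2) K0
    (fun t t01 => gramK _ _ (H1 t t01) wr).
  by rewrite [_ + (a - _)]addrC subrK !chartK// => H; exists l.
Unshelve. all: by end_near. Qed.

(** Finitely many neighbourhoods of the kind above cover X; go from x to the
    centre p of one, from p to another centre q, and from q to y. *)
Lemma compact_bounded_dist (X : set M) : compact X ->
  (forall x y, exists l, path_length g x y l) ->
  exists2 D, 0 <= D & forall x y, X x -> X y -> dist g x y <= D.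
Proof.
move=> cX conn.
have [K HK] := choice locally_bounded_dist.
have [l Hl] : {l : M * M -> R & forall z : M * M, path_length g z.1 z.2 (l z)}.
  exact: (choice (fun z : M * M => conn z.1 z.2)).
have [s Xs] := compact_finite_nbhs_cover cX HK.
pose S := \sum_(p <- s) `|K p|.
pose D := S + \sum_(p <- s) \sum_(q <- s) `|l (p, q)| + S.
have S0 : 0 <= S by apply: sumr_ge0.
have le_bigseq (F : M -> R) p : (forall q, 0 <= F q) -> p \in s -> F p <= \sum_(q <- s) F q.
  move=> F0 ps; rewrite (big_rem p)//= lerDl; exact: sumr_ge0.
exists D => [|x y /Xs[p ps [_ [l1 l1K xp]]] /Xs[q qs [[l2 l2K qy] _]]].
  by rewrite !addr_ge0//; apply: sumr_ge0 => p _; apply: sumr_ge0.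
apply: le_trans (dist_le (path_length_cat xp (path_length_cat (Hl (p, q)) qy))) _.
rewrite addrA /D !lerD//.
- apply: le_trans l1K _; apply: le_trans (ler_norm _) _.
  exact: (le_bigseq (fun p => `|K p|)).
- apply: le_trans (ler_norm _) _.
  apply: (le_trans (le_bigseq (fun q => `|l (p, q)|) q (fun=> normr_ge0 _) qs)).
  by apply: (le_bigseq (fun p => \sum_(q <- s) `|l (p, q)|)) => // p'; exact: sumr_ge0.
- apply: le_trans l2K _; apply: le_trans (ler_norm _) _.
  exact: (le_bigseq (fun p => `|K p|)).
Qed.

End diameter.

(** * Measurability of the pairing of two gradients *)

Section measurable_reals.
Context d (T : measurableType d) (R : realType).
Implicit Types (D : set T) (f : T -> R).

Lemma measurable_fun_inverse D f : measurable_fun D f ->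
  measurable_fun D (fun x => (f x)^-1).
Proof.
move=> mf; (* x^-1 = x * (x ^ 2)^-1, where the second factor is a power of a non-negative
   number, known to be measurable. *)
rewrite (_ : (fun x => _) = f \* (fun x => powR (f x ^+ 2) (-1))).
  apply: measurable_funM => //.
  by apply: (measurableT_comp (measurable_powR _)) => //; exact: measurable_funX.
apply/funext => x /=; rewrite powR_inv1 ?sqr_ge0//.
have [->|fx0] := eqVneq (f x) 0; first by rewrite invr0 mul0r.
by rewrite expr2 invfM mulrA divff// mul1r.
Qed.

Lemma measurable_det D m (A : T -> 'M[R]_m) :
  (forall i j, measurable_fun D (fun x => A x i j)) ->
  measurable_fun D (fun x => \det (A x)).
Proof.
move=> mA; apply: measurable_sum => s; apply: measurable_funM; first exact: measurable_cst.
by apply: measurable_prod => i _; exact: mA.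
Qed.

Lemma measurable_invmx D m (A : T -> 'M[R]_m) :
  (forall i j, measurable_fun D (fun x => A x i j)) ->
  (forall x, D x -> A x \in unitmx) ->
  forall i j, measurable_fun D (fun x => invmx (A x) i j).
Proof.
move=> mA uA i j.
apply: (@eq_measurable_fun _ _ _ _ _
  (fun x => (\det (A x))^-1 * ((-1) ^+ (j + i) * \det (row' j (col' i (A x)))))).
  by move=> x; rewrite inE => /uA Ax; rewrite /invmx Ax !mxE.
apply: measurable_funM; first by apply: measurable_fun_inverse; exact: measurable_det.
apply: measurable_funM; first exact: measurable_cst.
by apply: measurable_det => i' j'; under eq_fun do rewrite !mxE; exact: mA.
Qed.

End measurable_reals.

Lemma open_preimage_on (S T : topologicalType) (U : set S) (f : S -> T) (O : set T) :
  open U -> (forall x, U x -> {for x, continuous f}) -> open O ->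
  open (U `&` f @^-1` O).
Proof.
rewrite !openE => oU cf oO x [Ux Ofx]; apply: filterI; first exact: oU.
by apply: cf => //; exact: oO.
Qed.

Section borel_sets.
Context {R : realType} {M : ptopologicalType}.

Lemma open_measurable_borel (U : set M) : open U -> measurable (U : set (borel M)).
Proof. exact: sub_sigma_algebra. Qed.

Lemma closed_measurable_borel (A : set M) : closed A -> measurable (A : set (borel M)).
Proof.
move=> cA; rewrite -[A]setCK; apply: measurableC; apply: open_measurable_borel.
exact: closed_openC.
Qed.

Lemma measurable_fun_continuous_on (U : set M) (f : M -> R) : open U ->
  (forall x, U x -> {for x, continuous f}) ->
  measurable_fun (U : set (borel M)) (f : borel M -> R).
Proof.
move=> oU cf; apply: (measurability _ (RGenOInfty.measurableE R)) => _ [_ [a ->] <-].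
apply: open_measurable_borel; exact: open_preimage_on.
Qed.

End borel_sets.

(** A gradient at x has its coordinates in the chart centred at x, and these charts
    depend on x in no measurable way; the pairing of two gradients does not. In a
    fixed chart p it is a polynomial in the partial derivatives and the entries of
    the inverse Gram matrix. *)
Section gradients.
Context {R : realType} {n : nat} {M : ptopologicalType}.
Variable g : riemannian R n M.
Implicit Types (x y z p q : M) (f h : M -> R).

Definition chart_partial p f x (j : 'I_n) : R :=
  'D_(delta_mx 0 j) (f \o chart_inv g p) (chart g p x).

Lemma derive_in_chart f p x v : mdifferentiable g f x -> dom g p x ->
  derivable (f \o chart_inv g p) (chart g p x) v /\
  'D_v (f \o chart_inv g p) (chart g p x) =
    inner g x (grad g f x) (tcoord g p x x v).
Proof.
move=> df px; rewrite inner_grad//.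
pose T := chart g x \o chart_inv g p.
have dT : differentiable T (chart g p x).
  by apply: transition_differentiable => //; exact: dom_center.
have eT : T (chart g p x) = chart g x x by rewrite /T /= chartK.
have df' : differentiable (f \o chart_inv g x) (T (chart g p x)) by rewrite eT.
have E : {near chart g p x, (f \o chart_inv g x) \o T =1 f \o chart_inv g p}.
  have : \forall u \near chart g p x, dom g x (chart_inv g p u).
    apply: chart_inv_continuous => //; rewrite chartK//.
    by apply: nbhs_dom; exact: dom_center.
  by apply: filterS => u xu; rewrite /T /= chartK.
split.
  apply: near_eq_derivable E _; apply: diff_derivable; exact: differentiable_comp.
by rewrite -(near_eq_derive v E) (derive_compose v dT df') eT.
Qed.

Definition chart_grad p f x : 'rV[R]_n :=
  (\row_j chart_partial p f x j) *m invmx (gram g p (chart g p x)).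

(** Both sides have the same inner product with every tangent vector. *)
Lemma grad_in_chart f p x : mdifferentiable g f x -> dom g p x ->
  grad g f x = tcoord g p x x (chart_grad p f x).
Proof.
move=> df px; have xx := dom_center g x.
apply/eqP; rewrite -subr_eq0; apply/eqP; apply: (@inner_eq0 _ _ _ g x).
set w := grad g f x - _; suff H v : inner g x w v = 0 by exact: H.
rewrite /w innerDl innerNl -(tcoordK v xx px); set v' := tcoord g x p x v.
apply/eqP; rewrite subr_eq0; apply/eqP.
rewrite {2}/inner gram_compat// /chart_grad mulmxKV ?gram_unit// mxE.
rewrite {1}[v']row_sum_delta /tcoord linear_sum -/(tcoord g p x x).
have -> (F : 'I_n -> 'rV[R]_n) : inner g x (grad g f x) (\sum_i F i) =
    \sum_i inner g x (grad g f x) (F i).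
  elim/big_rec2: _ => [|i a b _ <-]; first by rewrite innerC inner0l.
  by rewrite innerDr.
apply: eq_bigr => j _; rewrite linearZ/= innerZr !mxE mulrC; congr (_ * _).
by have [_ <-] := derive_in_chart (delta_mx 0 j) df px.
Qed.

Lemma inner_grad_in_chart f h p x : mdifferentiable g f x -> mdifferentiable g h x ->
  dom g p x -> inner g x (grad g f x) (grad g h x) =
    \sum_j chart_partial p f x j *
       \sum_i chart_partial p h x i * invmx (gram g p (chart g p x)) i j.
Proof.
move=> df dh px; rewrite (grad_in_chart df px) (grad_in_chart dh px).
rewrite /inner gram_compat//; last exact: dom_center.
rewrite /chart_grad mulmxKV ?gram_unit// mxE; apply: eq_bigr => j _.
by rewrite !mxE; congr (_ * _); apply: eq_bigr => i _; rewrite mxE.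
Qed.

Lemma mdifferentiable_continuous f x : mdifferentiable g f x -> {for x, continuous f}.
Proof.
move=> df; have xx := dom_center g x.
have c1 : {for x, continuous ((f \o chart_inv g x) \o chart g x)}.
  apply: continuous_comp; first exact: chart_continuous.
  exact: differentiable_continuous.
have E : {near x, (f \o chart_inv g x) \o chart g x =1 f}.
  by have := nbhs_dom xx; apply: filterS => z xz; rewrite /= chartK.
have e := nbhs_singleton E; rewrite /prop_for /continuous_at -e.
by apply: cvg_trans c1; exact: near_eq_cvg.
Qed.

(** x moved by 1 / (m + 1) in the j-th coordinate of the chart p, and left unmoved
    where this would leave the chart: with this default the shift is a total Borel
    map of M. *)
Definition chart_shift p (m : nat) j x : M :=
  let u := chart g p x + harmonic m *: delta_mx 0 j in
  if `[< dom g p x /\ (chart g p @` dom g p) u >] then chart_inv g p u else x.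

Lemma measurable_chart_shift p m j :
  measurable_fun setT (chart_shift p m j : borel M -> borel M).
Proof.
pose s (x : M) := chart g p x + harmonic m *: (delta_mx 0 j : 'rV[R]_n).
have cs x : dom g p x -> {for x, continuous s}.
  by move=> px; apply: cvgD; [exact: chart_continuous|exact: cvg_cst].
pose U := dom g p `&` s @^-1` (chart g p @` dom g p).
have oU : open U.
  by apply: open_preimage_on => //; [exact: dom_open|exact: cod_open].
have cU x : U x -> {for x, continuous (chart_inv g p \o s)}.
  move=> [px [z pz zs]]; apply: continuous_comp; first exact: cs.
  rewrite -zs; exact: chart_inv_continuous.
apply: (@measurability _ _ (borel M) (borel M) setT _ (@open M) erefl) => _ [W oW <-]; rewrite setTI.
have -> : chart_shift p m j @^-1` W =
    (U `&` (chart_inv g p \o s) @^-1` W) `|` (W `\` U).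
  apply/seteqP; split => x; rewrite /chart_shift /preimage /=.
  - by case: asboolP => [Ux Ox|nU Ox]; [left|right].
  - by case: asboolP => [Ux [[]//|[_ /(_ Ux)]]|nU [[]//|[]//]].
apply: measurableU; first by apply: open_measurable_borel; exact: open_preimage_on.
by apply: measurableD; exact: open_measurable_borel.
Qed.

Section joint.
Context d (T : measurableType d).

(** A partial derivative is a limit of difference quotients along 1 / (m + 1), and
    the shift turns each quotient into a combination of F and a Borel map. *)
Lemma measurable_chart_partial p (F : M -> T -> R) j :
  measurable_fun setT (fun z : (borel M * T)%type => F z.1 z.2) ->
  (forall x t, mdifferentiable g (F^~ t) x) ->
  measurable_fun ((fst : (borel M * T)%type -> borel M) @^-1` dom g p)
    (fun z : (borel M * T)%type => chart_partial p (F^~ z.2) z.1 j).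
Proof.
move=> mF dF.
apply: (measurable_fun_cvg (h := fun m (z : (borel M * T)%type) =>
  (harmonic m)^-1 * (F (chart_shift p m j z.1) z.2 - F z.1 z.2))).
  move=> m; apply: measurable_funTS; apply: measurable_funM; first exact: measurable_cst.
  apply: measurable_funB => //.
  have mS : measurable_fun setT (fun z : (borel M * T)%type =>
      ((chart_shift p m j z.1, z.2) : (borel M * T)%type)).
    apply: measurable_fun_pair => //.
    by apply: measurableT_comp => //; exact: measurable_chart_shift.
  exact: (measurableT_comp mF mS).
move=> [x t] /= px.
have [d1 _] := derive_in_chart (delta_mx 0 j) (dF x t) px.
have c1 : harmonic m @[m --> \oo] --> (0 : R) by exact: cvg_harmonic.
have inU : \forall m \near \oo,
    (chart g p @` dom g p) (chart g p x + harmonic m *: delta_mx 0 j).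
  have : (chart g p x + harmonic m *: delta_mx 0 j : 'rV[R]_n) @[m --> \oo] -->
      chart g p x.
    have := cvgD (cvg_cst (chart g p x)) (cvgZr_tmp (a := delta_mx 0 j : 'rV[R]_n) c1).
    rewrite scale0r addr0. exact.
  by apply; exact: nbhs_cod.
have E : \forall m \near \oo, (harmonic m)^-1 *:
    ((F^~ t \o chart_inv g p) (harmonic m *: delta_mx 0 j + chart g p x) -
      (F^~ t \o chart_inv g p) (chart g p x)) =
    (harmonic m)^-1 * (F (chart_shift p m j x) t - F x t).
  near=> m; rewrite /= chartK// /chart_shift asboolT; last by split => //; near: m.
  by rewrite [_ + chart g p x]addrC.
apply: cvg_trans; first exact: near_eq_cvg E.
have nh : harmonic m @[m --> \oo] --> (0 : R)^'.
  move=> A A0; have : \forall m \near \oo, harmonic m != 0 :> R -> A (harmonic m).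
    exact: (c1 _ A0).
  by apply: filterS => m; apply; rewrite gt_eqF//; exact: harmonic_gt0.
have d1' : (h^-1 *: ((F^~ t \o chart_inv g p) (h *: delta_mx 0 j + chart g p x) -
    (F^~ t \o chart_inv g p) (chart g p x))) @[h --> (0 : R)^'] -->
    chart_partial p (F^~ t) x j by exact: d1.
exact: cvg_comp nh d1'.
Unshelve. all: by end_near. Qed.

End joint.
End gradients.

Section inner_grad_measurable.
Context {R : realType} {n : nat} {M : ptopologicalType}.
Variable g : riemannian R n M.
Context d (T : measurableType d).
Variables (F H : M -> T -> R).
Hypothesis mF : measurable_fun setT (fun z : (borel M * T)%type => F z.1 z.2).
Hypothesis mH : measurable_fun setT (fun z : (borel M * T)%type => H z.1 z.2).
Hypothesis dF : forall x t, mdifferentiable g (F^~ t) x.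
Hypothesis dH : forall x t, mdifferentiable g (H^~ t) x.

Let pairing (z : (borel M * T)%type) : R :=
  inner g z.1 (grad g (F^~ z.2) z.1) (grad g (H^~ z.2) z.1).

Lemma measurable_fst_preimage (A : set (borel M)) : measurable A ->
  measurable ((fst : (borel M * T)%type -> borel M) @^-1` A).
Proof. by move=> mA; rewrite -[X in measurable X]setTI; exact: measurable_fst. Qed.

Lemma measurable_inner_grad_dom p :
  measurable_fun ((fst : (borel M * T)%type -> borel M) @^-1` dom g p) pairing.
Proof.
have mp : measurable (dom g p : set (borel M)).
  by apply: open_measurable_borel; exact: dom_open.
apply: (@eq_measurable_fun _ _ _ _ _ (fun z : (borel M * T)%type => \sum_j chart_partial g p (F^~ z.2) z.1 j *
   \sum_i chart_partial g p (H^~ z.2) z.1 i * invmx (gram g p (chart g p z.1)) i j)).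
  by move=> z; rewrite inE => /= pz; rewrite /pairing (inner_grad_in_chart (p := p)).
apply: measurable_sum => j; apply: measurable_funM; first exact: measurable_chart_partial.
apply: measurable_sum => i; apply: measurable_funM; first exact: measurable_chart_partial.
apply: (@measurable_comp _ _ _ _ _ _ (dom g p : set (borel M))
  (fun x : borel M => invmx (gram g p (chart g p x)) i j) _ fst) => //.
- by move=> _ [z pz <-].
- apply: measurable_invmx => [k l|x px]; last exact: (gram_unit px).
  apply: measurable_fun_continuous_on => [|x px]; first exact: dom_open.
  have cG := differentiable_continuous (gram_differentiable px).
  have cN := differentiable_continuous (differentiable_coord (gram g p (chart g p x)) k l).
  exact: (@continuous_comp _ _ _ (gram g p \o chart g p) (fun N : 'M[R]_n => N k l) x
    (@continuous_comp _ _ _ (chart g p) (gram g p) x (chart_continuous px) cG) cN).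
- by apply: measurable_funTS; exact: measurable_fst.
Qed.

(** Finitely many charts cover X, and on each the chart formula applies. *)
Lemma measurable_inner_grad (X : set M) : compact X -> measurable (X : set (borel M)) ->
  measurable_fun ((fst : (borel M * T)%type -> borel M) @^-1` X) pairing.
Proof.
move=> cX mX.
have [s Xs] := compact_finite_nbhs_cover cX (fun p => nbhs_dom (dom_center g p)).
pose E i := (fst : (borel M * T)%type -> borel M) @^-1` dom g (nth point s i).
have mE i : measurable (E i).
  by apply: measurable_fst_preimage; apply: open_measurable_borel; exact: dom_open.
have mEi i : measurable_fun (E i) pairing by exact: measurable_inner_grad_dom.
have mU := (measurable_fun_bigcup pairing mE).2 mEi.
apply: measurable_funS mU; first exact: bigcup_measurable.
move=> z /= /Xs[p ps pz]; exists (index p s) => //.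
by rewrite /E nth_index.
Qed.

End inner_grad_measurable.

(** * The gradient noise of one sample *)

Section gradient_noise.
Context {R : realType} {n : nat} {M : ptopologicalType}.
Variable g : riemannian R n M.
Variables (X : set M) (X_compact : compact X).
Context {dX : measure_display} {Xi : measurableType dX}.
Variables (P : probability Xi R) (supp : set Xi).
Hypotheses (supp_meas : measurable supp) (supp_full : P supp = 1%E).
Variable phi : M -> Xi -> R.
Hypothesis phi_meas : measurable_fun setT
  (fun z : (borel M * Xi)%type => phi z.1 z.2).
Hypothesis phi_diff : forall xi x, mdifferentiable g (phi^~ xi) x.
Hypothesis phi_unbiased : unbiased g P phi.
Let Phi := objective P phi.
Hypothesis Phi_diff : forall x, mdifferentiable g Phi x.
Variable C : R.
Hypothesis C_ge0 : 0 <= C.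
Hypothesis phi_bound : forall x xi, X x -> supp xi ->
  tnorm g x (grad g (phi^~ xi) x) <= C.

Lemma compact_measurable_borel : measurable (X : set (borel M)).
Proof.
apply: closed_measurable_borel; apply: compact_closed => //.
exact: (manifold_hausdorff g).
Qed.

(** Unbiasedness is assumed coordinatewise; the pairing with a fixed u is a fixed
    linear combination of the coordinates. *)
Lemma integral_inner_grad x u :
  P.-integrable setT (EFin \o (fun xi => inner g x (grad g (phi^~ xi) x) u)) /\
  (\int[P]_xi (inner g x (grad g (phi^~ xi) x) u)%:E =
    (inner g x (grad g Phi x) u)%:E)%E.
Proof.
pose a i := \sum_j gram g x (chart g x x) i j * u 0 j.
have E (v : 'rV[R]_n) : inner g x v u = \sum_i a i * v 0 i.
  rewrite /inner mulmx_form; apply: eq_bigr => i _.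
  by rewrite /a mulr_suml; apply: eq_bigr => j _; ring.
have I i : P.-integrable setT (fun xi => (a i)%:E * (grad g (phi^~ xi) x 0 i)%:E)%E.
  by apply: integrableZl => //; exact: (phi_unbiased x i).1.
have -> : EFin \o (fun xi => inner g x (grad g (phi^~ xi) x) u) =
    (fun xi => \sum_i ((a i)%:E * (grad g (phi^~ xi) x 0 i)%:E))%E.
  by apply/funext => xi /=; rewrite E -sumEFin.
split; first exact: integrable_sum.
under eq_integral => xi _ do rewrite E -sumEFin.
under eq_integral => xi _ do under eq_bigr => i _ do rewrite EFinM.
rewrite (@integral_sum _ _ _ P setT measurableT _ _ I) E -sumEFin; apply: eq_bigr => i _.
rewrite integralZl//; last exact: (phi_unbiased x i).1.
rewrite EFinM; congr (_ * _)%E.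
by have [_] := phi_unbiased x i; rewrite unlock.
Qed.

Lemma integral_supp (f : Xi -> \bar R) : P.-integrable setT f ->
  (\int[P]_xi f xi = \int[P]_(xi in supp) f xi)%E.
Proof.
move=> fi; have mN : measurable (~` supp) by exact: measurableC.
have N0 : P (~` supp) = 0%E by rewrite probability_setC// supp_full subee.
by rewrite (negligible_integral mN measurableT fi N0) setTD setCK.
Qed.

(** With u the gradient of the objective, |u| ^ 2 is the mean of the pairings of u
    with the stochastic gradients, hence at most C |u|. *)
Lemma grad_objective_bound x : X x -> tnorm g x (grad g Phi x) <= C.
Proof.
move=> Xx; set u := grad g Phi x.
have [I e] := integral_inner_grad x u.
have [->//|u0] := eqVneq (tnorm g x u) 0.
have up : 0 < tnorm g x u by rewrite lt_neqAle eq_sym u0 tnorm_ge0.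
rewrite -(ler_pM2r up) -expr2 tnorm_sqr -lee_fin -[leLHS]e integral_supp//.
have -> : ((C * tnorm g x u)%:E = \int[P]_(xi in supp) (C * tnorm g x u)%:E)%E.
  rewrite integral_cst//; set m := (X in (_ * X)%E).
  by rewrite (_ : m = 1%E) ?mule1.
apply: le_integral => //.
- exact: integrableS I.
- by apply: finite_measure_integrable_cst.
- move=> xi; rewrite inE => sxi; rewrite lee_fin.
  apply: le_trans (inner_tnorm_le _ _ _ _) _.
  by rewrite ler_wpM2r ?tnorm_ge0// phi_bound.
Qed.

Definition noise x xi : 'rV[R]_n := grad g (phi^~ xi) x - grad g Phi x.

Lemma innerBB x (a b c e : 'rV[R]_n) : inner g x (a - b) (c - e) =
  inner g x a c - inner g x a e + (inner g x b e - inner g x b c).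
Proof. by rewrite innerDl innerNl !innerDr !innerNr opprD opprK (addrC _ (inner g x b e)). Qed.

Lemma tnorm_noise x xi : X x -> supp xi -> tnorm g x (noise x xi) <= 2 * C.
Proof.
move=> Xx sxi.
have H1 := phi_bound Xx sxi; have H2 := grad_objective_bound Xx.
set u := grad g (phi^~ xi) x in H1 *; set v := grad g Phi x in H2 *.
have u0 := tnorm_ge0 g x u; have v0 := tnorm_ge0 g x v.
have C2 : 0 <= 2 * C by rewrite mulr_ge0.
rewrite -(@ler_pXn2r _ 2 isT)// ?nnegrE; last exact: tnorm_ge0.
rewrite tnorm_sqr /noise -/u -/v !(innerDl, innerDr, innerNl, innerNr) (innerC g x v u).
have := inner_tnorm_le g x u (- v); rewrite innerNr.
rewrite tnormN -!tnorm_sqr; move: (inner g x u v) => i H.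
set a := tnorm g x u in u0 H1 H *; set b := tnorm g x v in v0 H2 H *.
have ab : (a + b) ^+ 2 <= (2 * C) ^+ 2 by rewrite lerXn2r ?nnegrE; lra.
by apply: le_trans ab; rewrite sqrrD; lra.
Qed.

Let D : set ((borel M * Xi) * Xi)%type :=
  [set z | X z.1.1 /\ supp z.1.2 /\ supp z.2].

(** The pairing of the noises of two samples, cut off where C need not bound the
    gradients. The cut-off makes the function bounded and, for x in X, changes it
    only on a P-null set of either sample. *)
Definition noise_product : ((borel M * Xi) * Xi)%type -> R :=
  (fun z => inner g z.1.1 (noise z.1.1 z.1.2) (noise z.1.1 z.2)) \_ D.

Lemma noise_productE x xi xi' : X x -> supp xi -> supp xi' ->
  noise_product (x, xi, xi') = inner g x (noise x xi) (noise x xi').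
Proof. by move=> Xx s1 s2; rewrite /noise_product patchE mem_set. Qed.

Lemma measurable_noise_product : measurable_fun setT noise_product.
Proof.
have mX := compact_measurable_borel.
pose S := (borel M * (Xi * Xi))%type.
have m1 : measurable_fun setT (fun z : S => phi z.1 z.2.1).
  apply: (measurableT_comp phi_meas (g := fun z : S => (z.1, z.2.1))).
  apply: measurable_fun_pair => //.
  by apply: (measurableT_comp measurable_fst); exact: measurable_snd.
have m2 : measurable_fun setT (fun z : S => phi z.1 z.2.2).
  apply: (measurableT_comp phi_meas (g := fun z : S => (z.1, z.2.2))).
  apply: measurable_fun_pair => //.
  by apply: (measurableT_comp measurable_snd); exact: measurable_snd.
have m3 : measurable_fun setT (fun z : S => Phi z.1).
  apply: (measurableT_comp (f := Phi : borel M -> R)) => //.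
  apply: measurable_fun_continuous_on; first exact: openT.
  by move=> x _; exact: mdifferentiable_continuous.
have mI (F H : M -> (Xi * Xi)%type -> R) :
    measurable_fun setT (fun z : S => F z.1 z.2) ->
    measurable_fun setT (fun z : S => H z.1 z.2) ->
    (forall x t, mdifferentiable g (F^~ t) x) ->
    (forall x t, mdifferentiable g (H^~ t) x) ->
    measurable_fun ((fst : S -> borel M) @^-1` X) (fun z : S =>
      inner g z.1 (grad g (F^~ z.2) z.1) (grad g (H^~ z.2) z.1)).
  by move=> ? ? ? ?; exact: measurable_inner_grad.
have mS : measurable_fun ((fst : S -> borel M) @^-1` X) (fun z : S =>
    inner g z.1 (noise z.1 z.2.1) (noise z.1 z.2.2)).
  have d1 (x : M) (t : (Xi * Xi)%type) : mdifferentiable g (phi^~ t.1) x by exact: phi_diff.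
  have d2 (x : M) (t : (Xi * Xi)%type) : mdifferentiable g (phi^~ t.2) x by exact: phi_diff.
  have d3 (x : M) (t : (Xi * Xi)%type) : mdifferentiable g Phi x by exact: Phi_diff.
  have := measurable_funD (measurable_funB
    (mI (fun x t => phi x t.1) (fun x t => phi x t.2) m1 m2 d1 d2)
    (mI (fun x t => phi x t.1) (fun x t => Phi x) m1 m3 d1 d3))
   (measurable_funB
    (mI (fun x t => Phi x) (fun x t => Phi x) m3 m3 d3 d3)
    (mI (fun x t => Phi x) (fun x t => phi x t.2) m3 m2 d3 d2)).
  apply: eq_measurable_fun => z _ /=.
  by rewrite /noise innerBB.
have mD : measurable D.
  have -> : D = (X `*` supp) `*` supp by apply/seteqP; split => z /= [] => [? []|[]].
  by apply: measurableX => //; exact: measurableX.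
pose r (z : ((borel M * Xi) * Xi)%type) : S := (z.1.1, (z.1.2, z.2)).
have rD : r @` D `<=` (fst : S -> borel M) @^-1` X by move=> _ [z [Xz _] <-].
have mr : measurable_fun D r.
  apply: measurable_funTS; apply: measurable_fun_pair.
    by apply: (measurableT_comp measurable_fst); exact: measurable_fst.
  apply: measurable_fun_pair => //.
  by apply: (measurableT_comp measurable_snd); exact: measurable_fst.
have mXf : measurable ((fst : S -> borel M) @^-1` X) by exact: measurable_fst_preimage.
have H := measurable_comp mXf rD mS mr.
exact: ((measurable_restrictT _ mD).1 H).
Qed.

Lemma noise_product_bound z : `|noise_product z| <= 4 * C ^+ 2.
Proof.
rewrite /noise_product patchE; case: ifPn => [|_]; last first.
  by rewrite normr0 mulr_ge0// sqr_ge0.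
rewrite inE => -[Xz [s1 s2]].
have H1 := tnorm_noise Xz s1; have H2 := tnorm_noise Xz s2.
have := inner_tnorm_le g z.1.1 (noise z.1.1 z.1.2) (noise z.1.1 z.2).
have := inner_tnorm_le g z.1.1 (- noise z.1.1 z.1.2) (noise z.1.1 z.2).
rewrite tnormN innerNl; move: (inner _ _ _ _) H1 H2 (tnorm_ge0 g z.1.1 (noise z.1.1 z.1.2))
  (tnorm_ge0 g z.1.1 (noise z.1.1 z.2)) => i.
move: (tnorm _ _ _) (tnorm _ _ _) => a b H1 H2 a0 b0 H3 H4.
have ab : a * b <= 4 * C ^+ 2.
  by rewrite (_ : 4 * C ^+ 2 = (2 * C) * (2 * C)) ?ler_pM//; ring.
by rewrite ler_norml; apply/andP; split; lra.
Qed.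

(** For fixed x and xi this is the mean of the pairing of the centred noise with a
    fixed vector. *)
Lemma integral_noise_product (x : M) xi : (\int[P]_xi' (noise_product (x, xi, xi'))%:E = 0)%E.
Proof.
have [[Xx s1]|nXs] := pselect (X x /\ supp xi); last first.
  have E xi' : noise_product (x, xi, xi') = 0.
    by rewrite /noise_product patchE memNset// => -[Xx [s1 _]]; exact: nXs.
  by under eq_integral => xi' _ do rewrite E; exact: integral0.
have E xi' : (noise_product (x, xi, xi'))%:E = ((fun xi' => (inner g x (noise x xi')
    (noise x xi))%:E) \_ supp) xi'.
  rewrite patchE; case: ifPn; rewrite ?inE => s2.
    by rewrite (noise_productE Xx s1 s2) innerC.
  rewrite /noise_product patchE memNset//= => -[_ [_ s2']].
  by move: s2; rewrite notin_setE.
under eq_integral => xi' _ do rewrite E.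
have [I e] := integral_inner_grad x (noise x xi).
set u := noise x xi in I e *.
have En xi' : (inner g x (noise x xi') u)%:E = ((inner g x (grad g (phi^~ xi') x) u)%:E
   - (inner g x (grad g Phi x) u)%:E)%E.
  by rewrite /noise innerDl innerNl EFinB.
have I2 : P.-integrable setT (fun xi' => (inner g x (noise x xi') u)%:E).
  have := integrableB measurableT I
    (finite_measure_integrable_cst P (inner g x (grad g Phi x) u) measurableT).
  by apply: eq_integrable => // xi' _; rewrite En.
rewrite -integral_mkcond -(integral_supp I2).
under eq_integral => xi' _ do rewrite En.
rewrite integralB//; last exact: finite_measure_integrable_cst.
rewrite e integral_cst//; set m := (X in (_ * X)%E).
by rewrite (_ : m = 1%E) ?mule1 ?subee//; exact: probability_setT.
Qed.

End gradient_noise.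

(** * Integrals under independence *)

Section independence.
Local Open Scope ereal_scope.
Context {R : realType} {d d1 d2 : measure_display}.
Context {Omega : measurableType d} {T1 : measurableType d1} {T2 : measurableType d2}.
Variable mu : probability Omega R.

Lemma measurable_preimage (Z : Omega -> T1) (A : set T1) :
  measurable_fun setT Z -> measurable A -> measurable (Z @^-1` A).
Proof. by move=> mZ mA; rewrite -[X in measurable X]setTI; exact: mZ. Qed.

Lemma measure_rectangle_unique (m1 m2 : {measure set (T1 * T2) -> \bar R}) :
  (forall A B, measurable A -> measurable B -> m1 (A `*` B) = m2 (A `*` B)) ->
  m1 setT < +oo -> forall A, measurable A -> m1 A = m2 A.
Proof.
move=> m12 m1oo A mA.
apply: (measure_unique [set A `*` B | A in measurable & B in measurable] (fun=> setT)) => //.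
- exact: measurable_prod_measurableType.
- move=> _ _ [A1 mA1 [B1 mB1 <-]] [A2 mA2 [B2 mB2 <-]].
  exists (A1 `&` A2); first exact: measurableI.
  by exists (B1 `&` B2); [exact: measurableI|rewrite setXI].
- by move=> _; exists setT => //; exists setT => //; rewrite setXTT.
- by rewrite bigcup_const.
- by move=> _ [A1 mA1 [B1 mB1 <-]]; exact: m12.
Qed.

Lemma integral_mrestr (E : set Omega) (mE : measurable E) (f : Omega -> \bar R) :
  measurable_fun setT f -> (forall w, 0 <= f w) ->
  \int[mrestr mu mE]_w f w = \int[mu]_(w in E) f w.
Proof.
move=> mf f0; have mN : measurable (~` E) by exact: measurableC.
have N0 : mrestr mu mE (~` E) = 0 by rewrite /mrestr setICl measure0.
rewrite (ge0_negligible_integral mN measurableT mf (fun w _ => f0 w) N0).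
rewrite setTD setCK; apply: eq_measure_integral => A mA AE.
by rewrite -{2}(setIidl AE).
Qed.

(** The law of Z restricted to E is c times the law of Z. *)
Lemma ge0_integral_indep_event (Z : Omega -> T1) (E : set Omega) (c : {nonneg R})
    (f : T1 -> \bar R) :
  measurable_fun setT Z -> measurable E ->
  (forall A, measurable A -> mu (Z @^-1` A `&` E) = (c%:num)%:E * mu (Z @^-1` A)) ->
  measurable_fun setT f -> (forall z, 0 <= f z) ->
  \int[mu]_(w in E) f (Z w) = (c%:num)%:E * \int[mu]_w f (Z w).
Proof.
move=> mZ mE indep mf f0.
have mfZ : measurable_fun setT (f \o Z) by exact: measurableT_comp.
rewrite -(integral_mrestr mE mfZ (fun w => f0 (Z w))).
pose pE := (pushforward (mrestr mu mE) Z : {measure set T1 -> \bar R}).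
pose p1 := (pushforward mu Z : {measure set T1 -> \bar R}).
have f0' : {in setT, forall y, 0 <= f y} by move=> y _; exact: f0.
have eE := ge0_integral_pushforward mZ (mrestr mu mE) measurableT mf f0'.
have e1 := ge0_integral_pushforward mZ mu measurableT mf f0'.
rewrite preimage_setT in eE e1.
rewrite -[LHS]eE -[X in _ * X]e1.
rewrite -(ge0_integral_mscale (p1 mZ) measurableT c mf (fun z _ => f0 z)).
apply: (@eq_measure_integral _ _ _ _ (mscale c (p1 mZ)) (pE mZ)) => A mA _.
exact: indep.
Qed.

(** The law of (Z, Y) is the product of the law of Z and P, so the integral is
    iterated, with Y integrated first. *)
Lemma integral_indep_mean0 (Z : Omega -> T1) (Y : Omega -> T2) (P : probability T2 R)
    (F : T1 * T2 -> R) (B : R) :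
  measurable_fun setT Z -> measurable_fun setT Y ->
  (forall A1 A2, measurable A1 -> measurable A2 ->
     mu (Z @^-1` A1 `&` Y @^-1` A2) = mu (Z @^-1` A1) * P A2) ->
  measurable_fun setT F -> (forall z, `|F z| <= B)%R ->
  (forall a, \int[P]_b (F (a, b))%:E = 0) ->
  \int[mu]_w (F (Z w, Y w))%:E = 0.
Proof.
move=> mZ mY indep mF FB F0.
have mW : measurable_fun setT (fun w => (Z w, Y w)) by exact: measurable_fun_pair.
have mFW : measurable_fun setT (fun w => F (Z w, Y w)) by exact: (measurableT_comp mF mW).
have bounded_int d0 (T0 : measurableType d0) (m : {measure set T0 -> \bar R})
    (h : T0 -> R) : m setT < +oo -> measurable_fun setT h -> (forall z, `|h z| <= B)%R ->
    m.-integrable setT (EFin \o h).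
  move=> moo mh hB; apply: measurable_bounded_integrable => //.
  exists B; split; first exact: num_real.
  by move=> r Br z _; apply: le_trans (hB z) _; exact: ltW.
pose ZZ : {mfun Omega >-> T1} := HB.pack Z (isMeasurableFun.Build _ _ _ _ _ mZ).
pose nu := distribution mu ZZ.
have iF : (nu \x P).-integrable setT (EFin \o F).
  apply: bounded_int => //.
  have H : (nu \x P) setT < +oo by rewrite probability_setT ltry.
  exact: H.
have iFW : mu.-integrable ((fun w => (Z w, Y w)) @^-1` setT) ((EFin \o F) \o (fun w => (Z w, Y w))).
  rewrite preimage_setT; apply: bounded_int => //.
  have H : mu setT < +oo by rewrite probability_setT ltry.
  exact: H.
have mF' : measurable_fun setT (EFin \o F) by exact/measurable_EFinP.
have := integral_pushforward mW mF' iFW measurableT; rewrite preimage_setT => <-.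
pose p := (pushforward mu (fun w => (Z w, Y w)) : {measure set (T1 * T2) -> \bar R}).
have eqm : forall A, measurable A -> (nu \x P) A = p mW A.
  apply: (@product_measure_unique _ _ _ _ _ nu P (p mW)) => A1 A2 mA1 mA2.
  exact: indep.
have -> : \int[p mW]_z (EFin \o F) z = \int[nu \x P]_z (EFin \o F) z.
  by apply: eq_measure_integral => A mA _; exact: esym (eqm A mA).
rewrite -(integral12_prod_meas1 iF).
under eq_integral => a _ do rewrite /fubini_F F0.
exact: integral0.
Qed.

End independence.

(** * One deterministic Frank-Wolfe step *)

Section frank_wolfe_step.
Context {R : realType} {n : nat} {M : ptopologicalType}.
Variable g : riemannian R n M.
Variables (Log : M -> M -> 'rV[R]_n) (hLog : inverse_exp g Log).
Variables (Gamma : M -> M -> 'rV[R]_n -> 'rV[R]_n).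
Hypothesis hGamma : parallel_transport g Log Gamma.
Variables (X : set M) (f : M -> R) (L D C : R).
Hypothesis f_smooth : L_smooth g Gamma L f.
Hypothesis X_diam : forall x y, X x -> X y -> dist g x y <= D.
Hypothesis D0 : 0 <= D.
Hypothesis f_grad : forall x, X x -> tnorm g x (grad g f x) <= C.

Let gap := FW_gap g Log X f.

Lemma inner_Log_le x z u : X x -> X z -> inner g x u (Log x z) <= tnorm g x u * D.
Proof.
move=> Xx Xz; apply: le_trans (inner_tnorm_le _ _ _ _) _.
by rewrite ler_wpM2l ?tnorm_ge0// (Log_norm hLog) X_diam.
Qed.

Lemma gap_le x B : X x -> (forall z, X z -> - inner g x (grad g f x) (Log x z) <= B) ->
  gap x <= B.
Proof.
move=> Xx HB; apply: ge_sup; first by exists (inner g x (Log x x) (- grad g f x)); exists x.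
by move=> _ [z Xz <-]; rewrite innerNr innerC; exact: HB.
Qed.

Lemma gap_le_cst x : X x -> gap x <= D * C.
Proof.
move=> Xx; apply: gap_le => // z Xz; rewrite -innerNl.
apply: le_trans (inner_Log_le _ Xx Xz) _.
by rewrite tnormN mulrC ler_wpM2l// f_grad.
Qed.

Lemma gap_ge0 x : X x -> 0 <= gap x.
Proof.
move=> Xx; apply: ub_le_sup; last by exists x => //; rewrite (Logxx hLog) inner0l.
exists (D * C) => _ [z Xz <-]; rewrite innerC.
apply: le_trans (inner_Log_le _ Xx Xz) _.
by rewrite tnormN mulrC ler_wpM2l// f_grad.
Qed.

(** The step has size 1 / s and the direction y minimizes the linear form of the
    estimate v instead of the gradient of f. The descent lemma bounds the descent
    in the direction Log x y, and replacing y by any z costs twice the pairing of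
    the error v - grad f with vectors of length at most D. The weighted
    inequality 2 e <= s e ^ 2 + 1 / s trades the norm e of the error for its
    square, whose mean can be computed. *)
Lemma gap_step x y v c (s : R) : X x -> X y -> 1 <= s ->
  (forall z, X z -> inner g x v (Log x y) <= inner g x v (Log x z)) ->
  geodesic_between g Log x y c ->
  gap x <= s * (f x - f (c s^-1)) +
    D * (s * inner g x (v - grad g f x) (v - grad g f x) + s^-1) +
    s^-1 * (`|L| * D ^+ 2).
Proof.
move=> Xx Xy s1 v_min gc; apply: gap_le => // z Xz.
have s0 : 0 < s by lra.
have si0 : 0 < s^-1 by rewrite invr_gt0.
have si1 : 0 <= s^-1 <= 1 by rewrite ltW//= invf_le1.
have := smooth_descent hLog hGamma f_smooth gc si1 (X_diam Xx Xy).
set A := inner g x (grad g f x) (Log x y); set Q := `|L| * D ^+ 2.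
move=> /(ler_wpM2l (ltW s0)) H.
have {}H : - A <= s * (f x - f (c s^-1)) + s^-1 * Q.
  move: H; rewrite !mulrDr mulrA divff ?lt0r_neq0// mul1r expr2 !mulrA divff ?lt0r_neq0//.
  by rewrite mul1r; lra.
set e := tnorm g x (v - grad g f x).
have H1 : inner g x (v - grad g f x) (Log x z) <= e * D by exact: inner_Log_le.
have H2 : - inner g x (v - grad g f x) (Log x y) <= e * D.
  by rewrite -innerNl -[e]tnormN; exact: inner_Log_le.
have H3 := v_min z Xz.
have E w : inner g x (grad g f x) w = inner g x v w - inner g x (v - grad g f x) w.
  by rewrite innerDl innerNl opprD opprK addrA subrr add0r.
have H4 : - inner g x (grad g f x) (Log x z) <= - A + 2 * (e * D).
  by rewrite /A !E; lra.
have H5 : 2 * e <= s * e ^+ 2 + s^-1.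
  have : 0 <= s^-1 * (s * e - 1) ^+ 2 by rewrite mulr_ge0 ?sqr_ge0// ltW.
  have -> : s^-1 * (s * e - 1) ^+ 2 = s * e ^+ 2 + s^-1 - 2 * e.
    by field; rewrite lt0r_neq0.
  by rewrite subr_ge0.
rewrite -tnorm_sqr -/e.
have H6 : 2 * (e * D) <= D * (s * e ^+ 2 + s^-1).
  by rewrite mulrA mulrC; exact: ler_wpM2l.
lra.
Qed.

End frank_wolfe_step.

(** * Bounded measurable functions *)

Section bounded_measurable.
Context {R : realType} {d : measure_display} {T : measurableType d}.

Definition bounded_measurable (f : T -> R) : Prop :=
  measurable_fun setT f /\ exists B, forall t, `|f t| <= B.

Lemma bounded_measurable_integrable (mu : probability T R) f :
  bounded_measurable f -> mu.-integrable setT (EFin \o f).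
Proof.
move=> [mf [B fB]]; apply: measurable_bounded_integrable => //.
  have H : (mu setT < +oo)%E by rewrite probability_setT ltry.
  exact: H.
exists B; split; first exact: num_real.
by move=> r Br z _; apply: le_trans (fB z) _; exact: ltW.
Qed.

Lemma bounded_measurable_cst r : bounded_measurable (cst r).
Proof. by split; [exact: measurable_cst|exists `|r|]. Qed.

Lemma bounded_measurableD f h : bounded_measurable f -> bounded_measurable h ->
  bounded_measurable (fun t => f t + h t).
Proof.
move=> [mf [A fA]] [mh [B hB]]; split; first exact: measurable_funD.
by exists (A + B) => t; apply: le_trans (ler_normD _ _) _; exact: lerD.
Qed.

Lemma bounded_measurableM f h : bounded_measurable f -> bounded_measurable h ->
  bounded_measurable (fun t => f t * h t).
Proof.
move=> [mf [A fA]] [mh [B hB]]; split; first exact: measurable_funM.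
by exists (A * B) => t; rewrite normrM ler_pM.
Qed.

Lemma bounded_measurableZ r f : bounded_measurable f ->
  bounded_measurable (fun t => r * f t).
Proof. exact: (bounded_measurableM (bounded_measurable_cst r)). Qed.

Lemma bounded_measurableN f : bounded_measurable f ->
  bounded_measurable (fun t => - f t).
Proof.
move=> [mf [B fB]]; split; first exact: measurable_funN.
by exists B => t; rewrite normrN.
Qed.

Lemma bounded_measurable_sum m (f : 'I_m -> T -> R) :
  (forall i, bounded_measurable (f i)) -> bounded_measurable (fun t => \sum_i f i t).
Proof.
move=> H; split; first by apply: measurable_sum => i; exact: (H i).1.
have [B HB] := choice (fun i => (H i).2).
exists (\sum_i B i) => t; apply: le_trans (ler_norm_sum _ _ _) _.
by apply: ler_sum => i _.
Qed.

Lemma Rintegral_bigsum (mu : probability T R) m (f : 'I_m -> T -> R) :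
  (forall i, bounded_measurable (f i)) ->
  \int[mu]_t (\sum_i f i t) = \sum_i \int[mu]_t f i t.
Proof.
move=> H; rewrite /Rintegral.
under eq_integral => t _ do rewrite -sumEFin.
rewrite (@integral_sum _ _ _ mu setT measurableT _ (fun i t => (f i t)%:E)); last first.
  by move=> i; exact: bounded_measurable_integrable.
by rewrite -sum_fine// => i _; apply: integrable_fin_num => //; exact: bounded_measurable_integrable.
Qed.

Lemma le_Rintegral_bounded (mu : probability T R) f h : bounded_measurable f ->
  bounded_measurable h -> (forall t, f t <= h t) -> \int[mu]_t f t <= \int[mu]_t h t.
Proof. by move=> bf bh fh; apply: le_Rintegral => //; exact: bounded_measurable_integrable. Qed.

Lemma Rintegral_cstT (mu : probability T R) r : \int[mu]_t r = r.
Proof.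
rewrite Rintegral_cst//; set m := (X in fine X).
by rewrite (_ : m = 1%E) ?mulr1//; exact: probability_setT.
Qed.

Lemma RintegralD_bounded (mu : probability T R) f h : bounded_measurable f ->
  bounded_measurable h -> \int[mu]_t (f t + h t) = \int[mu]_t f t + \int[mu]_t h t.
Proof. by move=> bf bh; apply: RintegralD => //; exact: bounded_measurable_integrable. Qed.

Lemma RintegralZ_bounded (mu : probability T R) r f : bounded_measurable f ->
  \int[mu]_t (r * f t) = r * \int[mu]_t f t.
Proof. by move=> bf; apply: RintegralZl => //; exact: bounded_measurable_integrable. Qed.

End bounded_measurable.

(** * Measurability and independence along a run *)

Section srfw.
Context {R : realType} {n : nat} {M : ptopologicalType}.
Variable g : riemannian R n M.
Variables (Log : M -> M -> 'rV[R]_n) (X : set M).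
Hypothesis X_convex : geodesically_convex g Log X.
Context {dX : measure_display} {Xi : measurableType dX}.
Variables (P : probability Xi R) (supp : set Xi).
Hypotheses (supp_meas : measurable supp) (supp_full : P supp = 1%E).
Variable phi : M -> Xi -> R.
Variables (x0 : M) (Xx0 : X x0) (K : nat) (b : nat -> nat) (eta : nat -> R).
Hypothesis eta01 : forall k, (k < K)%N -> 0 <= eta k <= 1.
Context {d : measure_display} {Omega : measurableType d}.
Variables (mu : probability Omega R) (xi : nat -> nat -> Omega -> Xi).
Variables (x y : nat -> Omega -> M) (kappa : Omega -> nat).
Hypothesis run : srfw_run g Log X P phi x0 K b eta mu xi x y kappa.

(* Functions of the past are functions on Omega with the smaller sigma-algebra. *)
Local Notation past_of := (past b xi x y).
Local Notation past_algebra k := (g_sigma_algebraType (past_of k)).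

Lemma iterate_in_X k w : (k <= K)%N -> X (x k w).
Proof.
elim: k => [_|k IH kK]; first by rewrite (run_init run).
have [c [gc ->]] := run_step run w kK.
exact: (X_convex (IH (ltnW kK)) (run_oracle run w kK).1 gc (eta01 kK)).
Qed.

Lemma past_measurable k A : (k <= K)%N -> <<s past_of k >> A -> measurable A.
Proof.
move=> kK; apply: smallest_sub; first exact: sigma_algebra_measurable.
move=> _ [[[j [B [jk mB ->]]]|[j [B [jk mB ->]]]]|[j [i [B [jk ib mB ->]]]]].
- rewrite -[X in measurable X]setTI.
  by apply: (run_x_measurable run (leq_trans jk kK)).
- rewrite -[X in measurable X]setTI.
  by apply: (run_y_measurable run (leq_trans jk kK)).
- rewrite -[X in measurable X]setTI.
  by apply: (run_xi_measurable run (leq_trans jk kK) ib).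
Qed.

Lemma measurable_id_past k : (k <= K)%N ->
  measurable_fun setT (id : Omega -> past_algebra k).
Proof. by move=> kK _ A mA; rewrite setTI; exact: past_measurable mA. Qed.

Lemma measurable_iterate_past k j : (j <= k)%N ->
  measurable_fun setT (x j : past_algebra k -> borel M).
Proof.
move=> jk _ B mB; rewrite setTI; apply: sub_sigma_algebra.
by left; left; exists j, B.
Qed.

Lemma measurable_sample_past k j i : (j < k)%N -> (i < b j)%N ->
  measurable_fun setT (xi j i : past_algebra k -> Xi).
Proof.
move=> jk ib _ B mB; rewrite setTI; apply: sub_sigma_algebra.
by right; exists j, i, B.
Qed.

Lemma bounded_measurable_past k (f : Omega -> R) : (k <= K)%N ->
  bounded_measurable (f : past_algebra k -> R) -> bounded_measurable f.
Proof.
move=> kK [mf fB]; split => //.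
exact: (measurableT_comp mf (measurable_id_past kK)).
Qed.

Section iteration.
Variables (k : nat) (kK : (k < K)%N).
Let mx := run_x_measurable run (ltnW kK).
Let mxi i (ib : (i < b k)%N) := run_xi_measurable run kK ib.

(** The other samples of the minibatch are given the trivial constraint setT. *)
Lemma fresh_pair i j (A : set (borel M)) (B1 B2 : set Xi) :
  (i < b k)%N -> (j < b k)%N -> i != j ->
  measurable A -> measurable B1 -> measurable B2 ->
  mu (x k @^-1` A `&` (xi k i @^-1` B1 `&` xi k j @^-1` B2)) =
  (mu (x k @^-1` A) * P B1 * P B2)%E.
Proof.
move=> ib jb ij mA mB1 mB2.
pose B m := if m == i then B1 else if m == j then B2 else setT.
have mB m : measurable (B m) by rewrite /B; case: ifP => // _; case: ifP.
have pA : <<s past_of k >> (x k @^-1` A) by apply: sub_sigma_algebra; left; left; exists k, A.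
have -> : xi k i @^-1` B1 `&` xi k j @^-1` B2 = \bigcap_(m in `I_(b k)) (xi k m @^-1` B m).
  apply/seteqP; split => w.
    move=> [w1 w2] m _; rewrite /B /preimage/=.
    by case: eqP => [->//|_]; case: eqP => [->|].
  move=> H; split; first by have := H i ib; rewrite /B /preimage/= eqxx.
  by have := H j jb; rewrite /B /preimage/= eq_sym (negPf ij) eqxx.
rewrite (run_fresh run kK pA mB) -muleA; congr (_ * _)%E.
rewrite (bigD1 (Ordinal ib))//= (bigD1 (Ordinal jb))/=; last first.
  by rewrite -val_eqE/= eq_sym.
rewrite big1 => [|m /andP[mi mj]].
  by rewrite mule1 /B eqxx eq_sym (negPf ij) eqxx.
rewrite /B -!val_eqE/= in mi mj *.
by rewrite (negPf mi) (negPf mj) probability_setT.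
Qed.

Lemma fresh_one i (A : set (borel M)) (B1 : set Xi) :
  (i < b k)%N -> measurable A -> measurable B1 ->
  mu (x k @^-1` A `&` xi k i @^-1` B1) = (mu (x k @^-1` A) * P B1)%E.
Proof.
move=> ib mA mB1.
pose B m := if m == i then B1 else setT.
have mB m : measurable (B m) by rewrite /B; case: ifP.
have pA : <<s past_of k >> (x k @^-1` A) by apply: sub_sigma_algebra; left; left; exists k, A.
have -> : xi k i @^-1` B1 = \bigcap_(m in `I_(b k)) (xi k m @^-1` B m).
  apply/seteqP; split => w.
    by move=> w1 m _; rewrite /B /preimage/=; case: eqP => [->//|_].
  by move=> /(_ i ib); rewrite /B /preimage/= eqxx.
rewrite (run_fresh run kK pA mB); congr (_ * _)%E.
rewrite (bigD1 (Ordinal ib))//= big1 => [|m mi]; first by rewrite mule1 /B eqxx.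
by rewrite /B -!val_eqE/= in mi *; rewrite (negPf mi) probability_setT.
Qed.

Lemma sample_notin_supp i : (i < b k)%N -> mu (xi k i @^-1` (~` supp)) = 0%E.
Proof.
move=> ib; have mN : measurable (~` supp) by exact: measurableC.
have := fresh_one ib measurableT mN.
by rewrite preimage_setT setTI probability_setC// supp_full subee// mule0.
Qed.

(** The product rule for rectangles, extended to all events of (x_k, xi_i). *)
Lemma fresh_sample_indep i j (A : set (borel M * Xi)%type) (B : set Xi) :
  (i < b k)%N -> (j < b k)%N -> i != j -> measurable A -> measurable B ->
  mu ((fun w => (x k w, xi k i w)) @^-1` A `&` xi k j @^-1` B) =
  (mu ((fun w => (x k w, xi k i w)) @^-1` A) * P B)%E.
Proof.
move=> ib jb ij mA mB.
pose Z w : (borel M * Xi)%type := (x k w, xi k i w).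
have mZ : measurable_fun setT Z by apply: measurable_fun_pair; [exact: mx|exact: mxi].
have mE : measurable (xi k j @^-1` B) by exact: (measurable_preimage (mxi jb)).
pose c : {nonneg R} := NngNum (fine_ge0 (measure_ge0 P B)).
have cE : ((c%:num)%:E = P B)%E by rewrite /= fineK// fin_num_measure.
pose pE := (pushforward (mrestr mu mE) Z : {measure set (borel M * Xi)%type -> \bar R}).
pose p := (pushforward mu Z : {measure set (borel M * Xi)%type -> \bar R}).
have := @measure_rectangle_unique _ _ _ _ _ (pE mZ) (mscale c (p mZ)).
move=> /(_ _ _ A mA) H; rewrite muleC -cE; apply: H => [A1 A2 mA1 mA2|].
  have e1 : pE mZ (A1 `*` A2) = mu (x k @^-1` A1 `&` (xi k i @^-1` A2 `&` xi k j @^-1` B)).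
    by rewrite setIA.
  have e2 : mscale c (p mZ) (A1 `*` A2) =
      ((c%:num)%:E * mu (x k @^-1` A1 `&` xi k i @^-1` A2))%E by [].
  apply: etrans e1 (etrans _ (esym e2)).
  by rewrite fresh_pair// fresh_one// cE muleC.
have H : (mu (Z @^-1` setT `&` xi k j @^-1` B) < +oo)%E.
  by rewrite preimage_setT setTI; apply: le_lt_trans (probability_le1 mu mE) (ltry 1).
exact: H.
Qed.

End iteration.

Lemma integral_output_event k (f : Omega -> R) : (k < K)%N ->
  measurable_fun setT (f : past_algebra K -> R) -> (forall w, 0 <= f w) ->
  (\int[mu]_(w in kappa @^-1` [set k]) (f w)%:E = (K%:R^-1)%:E * \int[mu]_w (f w)%:E)%E.
Proof.
move=> kK mf f0.
have c0 : 0 <= K%:R^-1 :> R by rewrite invr_ge0.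
pose c : {nonneg R} := NngNum c0.
have mE : measurable (kappa @^-1` [set k]).
  by rewrite -[X in measurable X]setTI; exact: (run_kappa_measurable run).
apply: (@ge0_integral_indep_event _ _ _ _ (past_algebra K) mu id _ c
  (fun w => (f w)%:E)) => //.
- exact: measurable_id_past.
- by move=> A mA; rewrite (run_output run kK mA) muleC.
- exact/measurable_EFinP.
Qed.

End srfw.

(** * The expected gap of the output *)

Section convergence.
Context {R : realType} {n : nat} {M : ptopologicalType}.
Variable g : riemannian R n M.
Variables (Log : M -> M -> 'rV[R]_n) (hLog : inverse_exp g Log).
Variables (Gamma : M -> M -> 'rV[R]_n -> 'rV[R]_n).
Hypothesis hGamma : parallel_transport g Log Gamma.
Variables (X : set M) (X_compact : compact X).
Hypothesis X_convex : geodesically_convex g Log X.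
Context {dX : measure_display} {Xi : measurableType dX}.
Variables (P : probability Xi R) (supp : set Xi).
Hypotheses (supp_meas : measurable supp) (supp_full : P supp = 1%E).
Variable phi : M -> Xi -> R.
Hypothesis phi_meas : measurable_fun setT
  (fun z : (borel M * Xi)%type => phi z.1 z.2).
Hypothesis phi_diff : forall xi x, mdifferentiable g (phi^~ xi) x.
Hypothesis phi_unbiased : unbiased g P phi.
Let Phi := objective P phi.
Variables (L C D F : R).
Hypothesis Phi_smooth : L_smooth g Gamma L Phi.
Hypothesis C_ge0 : 0 <= C.
Hypothesis phi_bound : forall x xi, X x -> supp xi ->
  tnorm g x (grad g (phi^~ xi) x) <= C.
Hypothesis D_ge0 : 0 <= D.
Hypothesis X_diam : forall x y, X x -> X y -> dist g x y <= D.
Hypothesis Phi_bound : forall x, X x -> `|Phi x| <= F.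
Variables (x0 : M) (Xx0 : X x0) (K : nat) (K_gt0 : (0 < K)%N).
Context {d : measure_display} {Omega : measurableType d}.
Variables (mu : probability Omega R) (xi : nat -> nat -> Omega -> Xi).
Variables (x y : nat -> Omega -> M) (kappa : Omega -> nat).
Variable s : R.
Hypotheses (s_ge1 : 1 <= s) (s_sqr : s * s = K%:R).
Hypothesis run : srfw_run g Log X P phi x0 K (fun _ => K) (fun _ => s^-1)
  mu xi x y kappa.

Local Notation gap := (FW_gap g Log X Phi).
Local Notation past_algebra := (g_sigma_algebraType (past (fun _ => K) xi x y K)).

Let s_gt0 : 0 < s. Proof. exact: lt_le_trans s_ge1. Qed.

Let K_neq0 : K%:R != 0 :> R. Proof. by rewrite pnatr_eq0 -lt0n. Qed.

Let s_step k : (k < K)%N -> 0 <= s^-1 <= 1.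
Proof. by move=> _; rewrite invr_ge0 ltW//= invf_le1. Qed.

Let Phi_diff x : mdifferentiable g Phi x := Phi_smooth.1 x.

Let inX k w : (k <= K)%N -> X (x k w) := @iterate_in_X _ _ _ _ _ _ X_convex _ _ _ _
  _ Xx0 _ _ _ s_step _ _ _ _ _ _ _ run k w.

Let F_ge0 : 0 <= F. Proof. exact: le_trans (Phi_bound Xx0). Qed.

Let NP k i j w : R := noise_product g X P supp phi (x k w, xi k i w, xi k j w).

Let outside k w : R := \sum_(i < K) \1_(~` supp) (xi k i w).

(* W is so large that, if some sample of iteration k falls outside supp, the last
   term of the bound below compensates all others and still exceeds the gap. *)
Let W : R := D * C + s * (2 * F) + D * (s * (4 * C ^+ 2)).

Let mean_product k w : R := (K%:R ^- 2) * \sum_(i < K) \sum_(j < K) NP k i j w.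

Let bound k w : R := s * (Phi (x k w) - Phi (x k.+1 w)) +
  D * (s * mean_product k w + s^-1) + s^-1 * (`|L| * D ^+ 2) + W * outside k w.

Let NP_bound k i j w : `|NP k i j w| <= 4 * C ^+ 2.
Proof. exact: noise_product_bound. Qed.

Let mean_product_bound k w : - (4 * C ^+ 2) <= mean_product k w.
Proof.
rewrite /mean_product [leRHS]mulrC ler_pdivlMr ?exprn_gt0 ?ltr0n//.
have -> : - (4 * C ^+ 2) * K%:R ^+ 2 = \sum_(i < K) \sum_(j < K) - (4 * C ^+ 2).
  by rewrite !sumr_const !card_ord -mulrnA -[RHS]mulr_natr natrM expr2.
apply: ler_sum => i _; apply: ler_sum => j _.
by have := NP_bound k i j w; rewrite ler_norml => /andP[].
Qed.

(* The minibatch error is the mean of the noises of the K samples. *)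
Let minibatch_error k w : (k < K)%N -> (forall i, (i < K)%N -> supp (xi k i w)) ->
  let e := minibatch_grad g phi (fun _ => K) xi x k w - grad g Phi (x k w) in
  inner g (x k w) e e = mean_product k w.
Proof.
move=> kK hs e.
have -> : e = K%:R^-1 *: \sum_(i < K) noise g P phi (x k w) (xi k i w).
  rewrite /e /minibatch_grad /noise big_split/= sumr_const card_ord -[(- _) *+ K]scaler_nat.
  by rewrite scalerDr scalerA mulVf// scale1r.
rewrite innerZl innerZr mulrA -invfM -expr2; congr (_ * _).
have suml (I : finType) z (f : I -> 'rV[R]_n) v :
    inner g z (\sum_i f i) v = \sum_i inner g z (f i) v.
  elim/big_rec2: _ => [|i a c _ <-]; first exact: inner0l.
  by rewrite innerDl.
rewrite suml; apply: eq_bigr => i _; rewrite innerC suml; apply: eq_bigr => j _.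
rewrite innerC; apply: esym.
exact: (noise_productE g P phi (inX w (ltnW kK)) (hs i (ltn_ord i)) (hs j (ltn_ord j))).
Qed.

Let gap_le_bound k w : (k < K)%N -> gap (x k w) <= bound k w.
Proof.
move=> kK; have Xk := inX w (ltnW kK); have Xk1 := inX w kK.
have grad_le z : X z -> tnorm g z (grad g Phi z) <= C.
  by move=> Xz; exact: (grad_objective_bound supp_meas supp_full phi_unbiased C_ge0 phi_bound Xz).
have [hs|/existsNP[i /not_implyP[iK nsi]]] :=
    pselect (forall i, (i < K)%N -> supp (xi k i w)).
  have -> : bound k w = s * (Phi (x k w) - Phi (x k.+1 w)) +
      D * (s * mean_product k w + s^-1) + s^-1 * (`|L| * D ^+ 2).
    rewrite /bound /outside big1 ?mulr0 ?addr0// => i _.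
    by rewrite indicE memNset//= => /(_ (hs i (ltn_ord i))).
  rewrite -minibatch_error//; have [c [gc ->]] := run_step run w kK.
  have [Xy ymin] := run_oracle run w kK.
  exact: (gap_step hLog hGamma Phi_smooth X_diam D_ge0 Xk Xy s_ge1 ymin gc).
apply: le_trans (gap_le_cst hLog X_diam D_ge0 grad_le Xk) _.
have out1 : 1 <= outside k w.
  rewrite /outside (bigD1 (Ordinal iK))//= indicE mem_set//= lerDl.
  by apply: sumr_ge0 => j _; rewrite indicE.
have := Phi_bound Xk; rewrite ler_norml => /andP[a1 _].
have := Phi_bound Xk1; rewrite ler_norml => /andP[_ a2].
have H1 : - (s * (2 * F)) <= s * (Phi (x k w) - Phi (x k.+1 w)).
  by rewrite -mulrN ler_wpM2l ?(ltW s_gt0)//; lra.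
have H2 : - (D * (s * (4 * C ^+ 2))) <= D * (s * mean_product k w + s^-1).
  rewrite -mulrN ler_wpM2l// -mulrN.
  apply: (@le_trans _ _ (s * mean_product k w)); last by rewrite lerDl invr_ge0 ltW.
  by apply: ler_wpM2l; [exact: ltW|exact: mean_product_bound].
have H3 : 0 <= s^-1 * (`|L| * D ^+ 2) by rewrite !mulr_ge0 ?invr_ge0 ?sqr_ge0// ltW.
have W0 : 0 <= W by rewrite /W !addr_ge0// !mulr_ge0 ?sqr_ge0// ltW.
have H4 : W <= W * outside k w by rewrite ler_peMr.
by rewrite /bound; move: H4; rewrite {1}/W; lra.
Qed.

Let bm_Phi k : (k <= K)%N -> bounded_measurable ((fun w => Phi (x k w)) : past_algebra -> R).
Proof.
move=> kK; split; last by exists F => w; apply: Phi_bound; exact: inX.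
apply: (measurableT_comp (f := Phi : borel M -> R)); last exact: measurable_iterate_past.
apply: measurable_fun_continuous_on; first exact: openT.
by move=> z _; exact: mdifferentiable_continuous.
Qed.

Let bm_NP k i j : (k < K)%N -> (i < K)%N -> (j < K)%N ->
  bounded_measurable (NP k i j : past_algebra -> R).
Proof.
move=> kK iK jK; split; last by exists (4 * C ^+ 2) => w; exact: NP_bound.
have mZ : measurable_fun setT
    ((fun w => (x k w, xi k i w, xi k j w)) : past_algebra -> ((borel M * Xi) * Xi)%type).
  apply: measurable_fun_pair; last exact: measurable_sample_past.
  apply: measurable_fun_pair; last exact: measurable_sample_past.
  by apply: measurable_iterate_past; exact: ltnW.
have mN := measurable_noise_product X_compact supp_meas phi_meas phi_diff Phi_diff.
exact: (measurableT_comp mN mZ).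
Qed.

Let bm_outside k (i : 'I_K) : (k < K)%N ->
  bounded_measurable ((fun w => \1_(~` supp) (xi k i w)) : past_algebra -> R).
Proof.
move=> kK; split; last first.
  by exists 1 => w; rewrite indicE; case: (_ \in _); rewrite ?normr1 ?normr0.
have mI : measurable_fun setT (\1_(~` supp) : Xi -> R).
  by apply: measurable_indic; exact: measurableC.
by apply: (measurableT_comp mI); exact: measurable_sample_past.
Qed.

Let bm_bound k : (k < K)%N -> bounded_measurable (bound k : past_algebra -> R).
Proof.
move=> kK; apply: bounded_measurableD; last first.
  by apply: bounded_measurableZ; apply: bounded_measurable_sum => i; exact: bm_outside.
apply: bounded_measurableD; last exact: bounded_measurable_cst.
apply: bounded_measurableD.
  apply: bounded_measurableZ; apply: bounded_measurableD; first exact: bm_Phi (ltnW kK).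
  exact: bounded_measurableN (bm_Phi kK).
apply: bounded_measurableZ; apply: bounded_measurableD; last exact: bounded_measurable_cst.
apply: bounded_measurableZ; apply: bounded_measurableZ.
apply: bounded_measurable_sum => i; apply: bounded_measurable_sum => j; exact: bm_NP.
Qed.

Let bmO (f : Omega -> R) : bounded_measurable (f : past_algebra -> R) -> bounded_measurable f.
Proof. exact: (bounded_measurable_past run (leqnn K)). Qed.

(* Distinct samples are uncorrelated, so only K of the K ^ 2 terms of the mean
   product contribute. *)
Let mean_NP k (i j : 'I_K) : (k < K)%N ->
  \int[mu]_w NP k i j w <= (if i == j then 4 * C ^+ 2 else 0).
Proof.
move=> kK; case: eqP => [->|/eqP ij].
  rewrite -[leRHS](Rintegral_cstT mu); apply: le_Rintegral_bounded.
  - by apply: bmO; exact: bm_NP.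
  - exact: bounded_measurable_cst.
  - by move=> w; have := NP_bound k j j w; rewrite ler_norml => /andP[].
rewrite /Rintegral (_ : (\int[mu]_w _)%E = 0%E)//.
apply: (@integral_indep_mean0 _ _ _ _ _ (borel M * Xi)%type _ mu
  (fun w => (x k w, xi k i w)) (xi k j) P (noise_product g X P supp phi) (4 * C ^+ 2)).
- apply: measurable_fun_pair; first exact: (run_x_measurable run (ltnW kK)).
  exact: (run_xi_measurable run kK).
- exact: (run_xi_measurable run kK).
- move=> A1 A2 mA1 mA2; exact: (fresh_sample_indep run kK).
- exact: measurable_noise_product.
- exact: noise_product_bound.
- by move=> [z t]; exact: integral_noise_product.
Qed.

Local Notation rate := (D * (4 * C ^+ 2 + 1) + `|L| * D ^+ 2).

Let mean_bound k : (k < K)%N -> \int[mu]_w bound k w <=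
  s * (\int[mu]_w Phi (x k w) - \int[mu]_w Phi (x k.+1 w)) + rate / s.
Proof.
move=> kK.
have b1 := bmO (bm_Phi (ltnW kK)); have b2 := bmO (bm_Phi kK).
have b2' := bounded_measurableN b2.
have b3 (i j : 'I_K) : bounded_measurable (NP k i j) by apply: bmO; exact: bm_NP.
have b4 (i : 'I_K) := bmO (bm_outside i kK).
have b3' (i : 'I_K) : bounded_measurable (fun w => \sum_(j < K) NP k i j w).
  by apply: bounded_measurable_sum => j.
have b3s := bounded_measurable_sum b3'.
have b4s := bounded_measurable_sum b4.
have b5 := bounded_measurableZ (K%:R ^- 2) b3s.
have b6 := bounded_measurableZ s b5.
have b7 := bounded_measurableD b6 (bounded_measurable_cst s^-1).
have b8 := bounded_measurableZ D b7.
have b9 := bounded_measurableZ s (bounded_measurableD b1 b2').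
have b10 := bounded_measurableD b9 b8.
have b11 := bounded_measurableD b10 (bounded_measurable_cst (s^-1 * (`|L| * D ^+ 2))).
have e1 : \int[mu]_w outside k w = 0.
  rewrite /outside (Rintegral_bigsum mu b4) big1// => i _.
  have mN : measurable (~` supp) by exact: measurableC.
  have mI : measurable (xi k i @^-1` (~` supp)).
    by rewrite -[X in measurable X]setTI; apply: (run_xi_measurable run kK).
  rewrite /Rintegral.
  have -> : (\int[mu]_w (\1_(~` supp) (xi k i w))%:E =
             \int[mu]_w (\1_(xi k i @^-1` (~` supp)) w)%:E)%E by [].
  rewrite integral_indic// setIT.
  exact: (congr1 fine (sample_notin_supp supp_meas supp_full run kK (ltn_ord i))).
have e2 : \int[mu]_w (- Phi (x k.+1 w)) = - \int[mu]_w Phi (x k.+1 w).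
  rewrite -mulN1r -RintegralZ_bounded//; congr (Rintegral _ _ _).
  by apply/funext => w; rewrite mulN1r.
have e3 : \int[mu]_w mean_product k w <= K%:R^-1 * (4 * C ^+ 2).
  rewrite /mean_product (RintegralZ_bounded mu _ b3s) (Rintegral_bigsum mu b3').
  have S : \sum_(i < K) \int[mu]_w (\sum_(j < K) NP k i j w) <= K%:R * (4 * C ^+ 2).
    apply: (@le_trans _ _ (\sum_(i < K) 4 * C ^+ 2)); last first.
      by rewrite sumr_const card_ord -[(4 * _) *+ K]mulr_natl.
    apply: ler_sum => i _; rewrite (Rintegral_bigsum mu (b3 i)).
    apply: (le_trans (ler_sum _ (fun j _ => mean_NP i j kK))).
    rewrite (bigD1 i)//= eqxx big1 ?addr0// => j /negPf.
    by rewrite eq_sym => ->.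
  apply: le_trans (ler_wpM2l _ S) _; first by rewrite invr_ge0 exprn_ge0.
  by rewrite (_ : K%:R ^- 2 * _ = K%:R^-1 * (4 * C ^+ 2))//; field.
rewrite (RintegralD_bounded mu b11 (bounded_measurableZ W b4s)).
rewrite (RintegralZ_bounded mu W b4s) -/(outside k _) e1 mulr0 addr0.
rewrite (RintegralD_bounded mu b10 (bounded_measurable_cst _)) Rintegral_cstT.
rewrite (RintegralD_bounded mu b9 b8) (RintegralZ_bounded mu s (bounded_measurableD b1 b2')).
rewrite (RintegralD_bounded mu b1 b2') e2 (RintegralZ_bounded mu D b7).
rewrite (RintegralD_bounded mu b6 (bounded_measurable_cst _)) Rintegral_cstT.
rewrite (RintegralZ_bounded mu s b5).
rewrite -!addrA lerD2l.
have -> : rate / s = D * (s * (K%:R^-1 * (4 * C ^+ 2)) + s^-1) + s^-1 * (`|L| * D ^+ 2).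
  by rewrite -s_sqr; field; exact: lt0r_neq0.
by rewrite lerD2r ler_wpM2l// lerD2r ler_wpM2l// ltW.
Qed.

Let bound_ge0 k w : (k < K)%N -> 0 <= bound k w.
Proof.
move=> kK; apply: le_trans (gap_le_bound w kK).
apply: (gap_ge0 hLog X_diam D_ge0 (C := C)); last exact: inX (ltnW kK).
by move=> z Xz; exact: (grad_objective_bound supp_meas supp_full phi_unbiased C_ge0 phi_bound Xz).
Qed.

Let integral_output_bound (k : 'I_K) :
  (\int[mu]_(w in kappa @^-1` [set val k]) (bound k w)%:E =
   (K%:R^-1 * \int[mu]_w bound k w)%:E)%E.
Proof.
have kK := ltn_ord k.
rewrite (integral_output_event run kK (bm_bound kK).1 (fun w => bound_ge0 w kK)).
rewrite EFinM; congr (_ * _)%E; rewrite fineK//.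
by apply: integrable_fin_num => //; apply: bounded_measurable_integrable; exact: bmO (bm_bound kK).
Qed.

(* The differences of successive objective values telescope. *)
Let sum_mean_bound : \sum_(k < K) \int[mu]_w bound k w <= s * (2 * F) + K%:R * (rate / s).
Proof.
pose a k := \int[mu]_w Phi (x k w).
have aF k : (k <= K)%N -> - F <= a k <= F.
  move=> kK; have bk := bmO (bm_Phi kK); have H w := Phi_bound (inX w kK).
  rewrite -[- F](Rintegral_cstT mu) -[X in _ <= _ <= X](Rintegral_cstT mu).
  apply/andP; split; apply: le_Rintegral_bounded => //; try exact: bounded_measurable_cst.
  - by move=> w; have := H w; rewrite ler_norml => /andP[].
  - by move=> w; have := H w; rewrite ler_norml => /andP[].
apply: (@le_trans _ _ (\sum_(k < K) (s * (a k - a k.+1) + rate / s))).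
  by apply: ler_sum => k _; exact: mean_bound.
rewrite big_split/= sumr_const card_ord -[(rate / s) *+ K]mulr_natl lerD2r -mulr_sumr.
rewrite ler_wpM2l ?(ltW s_gt0)//.
rewrite -(big_mkord xpredT (fun k => a k - a k.+1)).
under eq_bigr => k _ do rewrite -opprB.
rewrite sumrN telescope_sumr// opprB.
by have /andP[_ h1] := aF 0%N (leq0n K); have /andP[h2 _] := aF K (leqnn K); lra.
Qed.

(** On the event kappa = k the gap of the output is below the bound for iteration
    k, which is a function of the past and so independent of that event. *)
Lemma srfw_expected_gap :
  ('E_mu[fun w => gap (output x kappa w)] <= ((2 * F + rate) / s)%:E)%E.
Proof.
rewrite unlock.
pose h (k : 'I_K) := (fun w => (bound k w)%:E) \_ (kappa @^-1` [set val k]).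
have h0 k w : (0 <= h k w)%E.
  by rewrite /h patchE; case: ifP => // _; rewrite lee_fin bound_ge0.
have mE (k : 'I_K) : measurable (kappa @^-1` [set val k]).
  by rewrite -[X in measurable X]setTI; exact: (run_kappa_measurable run).
have gap0 w : (0 <= (gap (output x kappa w))%:E)%E.
  rewrite lee_fin; apply: (gap_ge0 hLog X_diam D_ge0 (C := C)).
    by move=> z Xz; exact: (grad_objective_bound supp_meas supp_full phi_unbiased C_ge0 phi_bound Xz).
  by apply: inX; exact: ltnW (run_kappa_lt run w).
have gaph w : ((gap (output x kappa w))%:E <= \sum_(k < K) h k w)%E.
  have kw := run_kappa_lt run w.
  rewrite (bigD1 (Ordinal kw))//=; apply: (@le_trans _ _ (h (Ordinal kw) w)).
    by rewrite /h patchE mem_set//= lee_fin; exact: gap_le_bound.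
  by rewrite leeDl// sume_ge0.
apply: le_trans (ge0_le_integral_nonmeasurable mu (fun w _ => gap0 w) (fun w _ => gaph w)) _.
have mh (k : 'I_K) : measurable_fun setT (h k).
  apply: ((measurable_restrictT _ (mE k)).1 _); apply: measurable_funTS.
  by apply/measurable_EFinP; have [] := bmO (bm_bound (ltn_ord k)).
rewrite (ge0_integral_sum mu measurableT mh (fun k w _ => h0 k w)).
under eq_bigr => k _ do rewrite /h -integral_mkcond integral_output_bound.
rewrite sumEFin lee_fin -mulr_sumr mulrC ler_pdivrMr ?ltr0n//.
apply: le_trans sum_mean_bound _; rewrite -s_sqr le_eqVlt; apply/orP; left; apply/eqP.
by field; exact: lt0r_neq0.
Qed.

End convergence.

(** * The number of iterations *)

Section iteration_count.
Context {R : realType}.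
Variable B : R.
Hypothesis B_ge0 : 0 <= B.

Definition iterations (eps : R) : nat := (Num.truncn ((B / eps) ^+ 2)).+1.

Lemma rate_le_eps eps : 0 < eps -> B / Num.sqrt (iterations eps)%:R <= eps.
Proof.
move=> e0; have q0 : 0 <= B / eps by rewrite divr_ge0// ltW.
rewrite ler_pdivrMr ?sqrtr_gt0 ?ltr0n// mulrC -ler_pdivrMr//.
rewrite -[leLHS](ger0_norm q0) -sqrtr_sqr ler_wsqrtr//.
exact: ltW (truncnS_gt _).
Qed.

Lemma iterations_le eps : 0 < eps <= 1 -> (iterations eps)%:R <= (B ^+ 2 + 1) * eps ^- 2.
Proof.
move=> /andP[e0 e1]; rewrite -natr1 mulrDl mul1r lerD//.
  by rewrite -exprVn -exprMn truncn_le sqr_ge0.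
by rewrite -exprVn exprn_ege1// invf_ge1.
Qed.

Lemma near_right0 : \forall eps \near (0 : R)^'+, 0 < eps <= 1.
Proof.
near=> eps; apply/andP; split; first by near: eps; exact: nbhs_right_gt.
by apply: ltW; near: eps; apply: nbhs_right_lt.
Unshelve. all: by end_near. Qed.

Lemma rlo_complexity_bigO :
  (fun eps : R => (rlo_complexity (iterations eps))%:R : R)
    =O_ (0^'+) (fun eps : R => eps ^- 2).
Proof.
apply/eqO_exP; exists (B ^+ 2 + 1); first by rewrite ltr_wpDl ?sqr_ge0.
have := near_right0; apply: filterS => eps e01.
rewrite /rlo_complexity sum1_card card_ord ger0_norm//.
rewrite ger0_norm; first exact: iterations_le.
by rewrite invr_ge0 sqr_ge0.
Qed.

Lemma sfo_complexity_bigO :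
  (fun eps : R => (sfo_complexity (iterations eps) (fun _ => iterations eps))%:R : R)
    =O_ (0^'+) (fun eps : R => eps ^- 4).
Proof.
apply/eqO_exP; exists ((B ^+ 2 + 1) ^+ 2).
  by rewrite exprn_gt0// ltr_wpDl ?sqr_ge0.
have := near_right0; apply: filterS => eps e01.
rewrite /sfo_complexity sum_nat_const card_ord ger0_norm//.
rewrite ger0_norm; last by rewrite invr_ge0 exprn_even_ge0.
have -> : eps ^- 4 = (eps ^- 2) ^+ 2 by rewrite [RHS]exprVn -exprM.
by rewrite -exprMn natrM expr2 ler_pM// iterations_le.
Qed.

End iteration_count.

Lemma continuous_bounded_on_compact (R : realType) (T : topologicalType) (X : set T)
    (f : T -> R) : compact X -> (forall x, {for x, continuous f}) ->
  exists F, forall x, X x -> `|f x| <= F.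
Proof.
move=> cX cf.
have /compact_bounded[F [_ HF]] : compact (f @` X).
  by apply: continuous_compact => //; apply: continuous_subspaceT => x; exact: cf.
exists (F + 1) => x Xx; apply: (HF (F + 1)); first by rewrite ltrDl.
by exists x.
Qed.

Theorem corollary3p7
  (R : realType) (n : nat) (M : ptopologicalType) (g : riemannian R n M)
  (Log : M -> M -> 'rV[R]_n) (hLog : inverse_exp g Log)
  (Gamma : M -> M -> 'rV[R]_n -> 'rV[R]_n)
  (hGamma : parallel_transport g Log Gamma)
  (X : set M) (X_compact : compact X) (X_convex : geodesically_convex g Log X)
  (dX : measure_display) (Xi : measurableType dX) (P : probability Xi R)
  (supp : set Xi) (supp_meas : measurable supp) (supp_full : P supp = 1%E)
  (phi : M -> Xi -> R)
  (phi_meas : measurable_fun setT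
     (fun z : (borel M * Xi)%type => phi z.1 z.2))
  (phi_int : forall x, P.-integrable setT (EFin \o phi x))
  (phi_diff : forall xi x, mdifferentiable g (phi^~ xi) x)
  (phi_unbiased : unbiased g P phi)
  (L : R) (Phi_smooth : L_smooth g Gamma L (objective P phi))
  (C : R) (C_ge0 : 0 <= C)
  (phi_bound : forall x xi, X x -> supp xi ->
     tnorm g x (grad g (phi^~ xi) x) <= C)
  (x0 : M) (Xx0 : X x0) :
  exists K : R -> nat,
    (forall eps : R, 0 < eps ->
       (0 < K eps)%N /\
       forall (d : measure_display) (Omega : measurableType d)
         (mu : probability Omega R) (xi : nat -> nat -> Omega -> Xi)
         (x y : nat -> Omega -> M) (kappa : Omega -> nat),
       srfw_run g Log X P phi x0 (K eps)
         (fun _ => K eps) (fun _ => (Num.sqrt (K eps)%:R)^-1)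
         mu xi x y kappa ->
       ('E_mu[fun w => FW_gap g Log X (objective P phi) (output x kappa w)]
          <= eps%:E)%E) /\
    ((fun eps : R => (sfo_complexity (K eps) (fun _ => K eps))%:R : R)
       =O_ (0^'+) (fun eps : R => eps ^- 4)) /\
    ((fun eps : R => (rlo_complexity (K eps))%:R : R)
       =O_ (0^'+) (fun eps : R => eps ^- 2)).
Proof.
have conn p q : exists l, path_length g p q l.
  have [c [[cC _] <- _ <-]] := geodesic_between_exists hLog p q.
  by exists (curve_length g c); exact: path_length_curve.
have [D D0 X_diam] := compact_bounded_dist X_compact conn.
have [F Phi_bound] := continuous_bounded_on_compact X_compact
  (fun z => mdifferentiable_continuous (Phi_smooth.1 z)).
pose B := 2 * F + (D * (4 * C ^+ 2 + 1) + `|L| * D ^+ 2).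
have B0 : 0 <= B.
  have F0 : 0 <= F := le_trans (normr_ge0 _) (Phi_bound _ Xx0).
  by rewrite /B !addr_ge0// !mulr_ge0// ?addr_ge0 ?mulr_ge0 ?sqr_ge0.
exists (iterations B); split; last first.
  by split; [exact: sfo_complexity_bigO|exact: rlo_complexity_bigO].
move=> eps eps0; split=> // d Omega mu xi x y kappa run.
apply: le_trans (_ : _ <= (B / Num.sqrt (iterations B eps)%:R)%:E)%E _.
  have s1 : 1 <= Num.sqrt (iterations B eps)%:R :> R by rewrite -[leLHS]sqrtr1 ler_wsqrtr// ler1n.
  have s2 : Num.sqrt (iterations B eps)%:R * Num.sqrt (iterations B eps)%:R =
      (iterations B eps)%:R :> R by rewrite -expr2 sqr_sqrtr.
  exact: (srfw_expected_gap hLog hGamma X_compact X_convex supp_meas supp_full phi_meas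
    phi_diff phi_unbiased Phi_smooth C_ge0 phi_bound D0 X_diam Phi_bound Xx0
    (ltn0Sn _) s1 s2 run).
by rewrite lee_fin; exact: rate_le_eps.
Qed.
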